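(* Let $B$ be a real Banach space and $B_{\mathbb C}$ its complexification. Identifying a sequence $(f_k)_{k\ge0}$ with the power series $f(z)=\sum_{k=0}^\infty f_kz^k$, the space $\Sigma(B)$ consists of all $B_{\mathbb C}$-valued holomorphic functions $f$ on $\mathbb C$ such that $\overline{f(z)}=f(\overline z)$ for all $z\in\mathbb C$.
   Context: A sequence $(f_k)_{k\ge0}$ in a Banach space $B$ is exponentially decreasing if $\sum_k\|f_k\|e^{kn}<\infty$ for all $n\in\mathbb N$; $\Sigma(B)$ denotes the vector space of all exponentially decreasing sequences in $B$. The complexification $B_{\mathbb C}=B\oplus iB$ carries a usual complexification norm (a complex Banach norm inducing the given norm on $B$, for which conjugation is isometric), and $\overline{x+iy}=x-iy$ for $x,y\in B$. *)

(* Defs.v *)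
From Stdlib Require Import Reals Lra.
From Coquelicot Require Import Coquelicot.
Open Scope R_scope.

(* [Cplx x y] is x + iy. *)
Record cplx (B : Type) : Type := Cplx { cplx_re : B; cplx_im : B }.
Arguments Cplx {B} cplx_re cplx_im.
Arguments cplx_re {B} c.
Arguments cplx_im {B} c.

Section ComplexVectorSpace.

Variable B : ModuleSpace R_Ring.

Definition cplx_plus (u v : cplx B) : cplx B :=
  Cplx (plus (cplx_re u) (cplx_re v)) (plus (cplx_im u) (cplx_im v)).

Definition cplx_zero : cplx B := Cplx zero zero.

Definition cplx_opp (u : cplx B) : cplx B :=
  Cplx (opp (cplx_re u)) (opp (cplx_im u)).

(* (s + it)(x + iy) = (sx - ty) + i(sy + tx) *)
Definition cplx_scal (c : C) (u : cplx B) : cplx B :=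
  Cplx (plus (scal (Re c) (cplx_re u)) (opp (scal (Im c) (cplx_im u))))
       (plus (scal (Re c) (cplx_im u)) (scal (Im c) (cplx_re u))).

Lemma cplx_plus_comm u v : cplx_plus u v = cplx_plus v u.
Proof. unfold cplx_plus; f_equal; apply plus_comm. Qed.

Lemma cplx_plus_assoc u v w :
  cplx_plus u (cplx_plus v w) = cplx_plus (cplx_plus u v) w.
Proof. unfold cplx_plus; simpl; f_equal; apply plus_assoc. Qed.

Lemma cplx_plus_zero_r u : cplx_plus u cplx_zero = u.
Proof. destruct u; unfold cplx_plus; simpl; f_equal; apply plus_zero_r. Qed.

Lemma cplx_plus_opp_r u : cplx_plus u (cplx_opp u) = cplx_zero.
Proof. unfold cplx_plus, cplx_zero; simpl; f_equal;
  apply (plus_opp_r (G := B)). Qed.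

Definition cplx_AbelianMonoid_mixin :=
  AbelianMonoid.Mixin (cplx B) cplx_plus cplx_zero
    cplx_plus_comm cplx_plus_assoc cplx_plus_zero_r.

Canonical cplx_AbelianMonoid :=
  AbelianMonoid.Pack (cplx B) cplx_AbelianMonoid_mixin (cplx B).

Definition cplx_AbelianGroup_mixin :=
  AbelianGroup.Mixin cplx_AbelianMonoid cplx_opp cplx_plus_opp_r.

Canonical cplx_AbelianGroup :=
  AbelianGroup.Pack (cplx B)
    (AbelianGroup.Class _ cplx_AbelianMonoid_mixin cplx_AbelianGroup_mixin)
    (cplx B).

Lemma plus_swap (a b c d : B) :
  plus (plus a b) (plus c d) = plus (plus a c) (plus b d).
Proof.
rewrite <- !plus_assoc; f_equal.
rewrite !plus_assoc; f_equal; apply plus_comm.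
Qed.

Lemma scal_Rplus (s t : R) (x : B) :
  scal (s + t) x = plus (scal s x) (scal t x).
Proof. exact (scal_distr_r (K := R_Ring) s t x). Qed.

Lemma scal_Ropp (s : R) (x : B) : scal (- s) x = opp (scal s x).
Proof. exact (scal_opp_l (K := R_Ring) s x). Qed.

Lemma module_opp_zero : @opp B (@zero B) = @zero B.
Proof. exact (opp_zero (G := B)). Qed.

Lemma cplx_scal_assoc (c d : C_Ring) (u : cplx B) :
  cplx_scal c (cplx_scal d u) = cplx_scal (mult c d) u.
Proof.
destruct c as [a b], d as [p q], u as [x y].
unfold cplx_scal; simpl.
rewrite !scal_distr_l, !scal_opp_r, !scal_assoc.
change (@mult R_Ring) with Rmult; unfold Rminus.
rewrite !scal_Rplus, !scal_Ropp, !(opp_plus (G := B)).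
f_equal.
- rewrite (plus_comm (opp (scal (b * p) y)) (opp (scal (b * q) x))).
  rewrite plus_swap; f_equal.
- rewrite (plus_comm (scal (b * p) x) (opp (scal (b * q) y))).
  rewrite plus_swap; f_equal.
Qed.

Lemma cplx_scal_one (u : cplx B) : cplx_scal (@one C_Ring) u = u.
Proof.
destruct u as [x y]; unfold cplx_scal; simpl.
change 1 with (@one R_Ring); change 0 with (@zero R_Ring).
rewrite !scal_one, !scal_zero_l, module_opp_zero, !plus_zero_r; reflexivity.
Qed.

Lemma cplx_scal_distr_l (c : C_Ring) (u v : cplx B) :
  cplx_scal c (cplx_plus u v) = cplx_plus (cplx_scal c u) (cplx_scal c v).
Proof.
unfold cplx_scal, cplx_plus; simpl.
rewrite !scal_distr_l, (opp_plus (G := B)); f_equal; apply plus_swap.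
Qed.

Lemma cplx_scal_distr_r (c d : C_Ring) (u : cplx B) :
  cplx_scal (plus c d) u = cplx_plus (cplx_scal c u) (cplx_scal d u).
Proof.
destruct c as [a b], d as [p q].
unfold cplx_scal, cplx_plus; simpl.
rewrite !scal_Rplus, (opp_plus (G := B)); f_equal; apply plus_swap.
Qed.

Definition cplx_ModuleSpace_mixin :=
  ModuleSpace.Mixin C_Ring cplx_AbelianGroup cplx_scal
    cplx_scal_assoc cplx_scal_one cplx_scal_distr_l cplx_scal_distr_r.

Canonical cplx_ModuleSpace :=
  ModuleSpace.Pack C_Ring (cplx B)
    (ModuleSpace.Class _ _ (AbelianGroup.class cplx_AbelianGroup)
       cplx_ModuleSpace_mixin)
    (cplx B).

Definition cplx_conj (u : cplx B) : cplx B :=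
  Cplx (cplx_re u) (opp (cplx_im u)).

Definition of_real (x : B) : cplx B := Cplx x zero.

Lemma scal_Ci_of_real (y : B) : scal Ci (of_real y) = Cplx zero y.
Proof.
change (cplx_scal Ci (of_real y) = Cplx zero y).
unfold cplx_scal, of_real; simpl.
change 1 with (@one R_Ring); change 0 with (@zero R_Ring).
rewrite !scal_one, !scal_zero_r, !scal_zero_l, module_opp_zero.
rewrite !plus_zero_r, plus_zero_l; reflexivity.
Qed.

Lemma scal_2 (x : B) : scal 2 x = plus x x.
Proof.
change 2 with (1 + 1); rewrite scal_Rplus; f_equal; exact (scal_one x).
Qed.

Lemma plus_conj (u : cplx B) :
  plus u (cplx_conj u) = of_real (scal 2 (cplx_re u)).
Proof.
rewrite scal_2.
change (cplx_plus u (cplx_conj u) = of_real (plus (cplx_re u) (cplx_re u))).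
unfold cplx_plus, of_real; simpl; f_equal.
exact (plus_opp_r (G := B) _).
Qed.

Lemma minus_conj (u : cplx B) :
  minus u (cplx_conj u) = Cplx zero (scal 2 (cplx_im u)).
Proof.
rewrite scal_2.
change (cplx_plus u (cplx_opp (cplx_conj u))
        = Cplx zero (plus (cplx_im u) (cplx_im u))).
unfold cplx_plus; simpl; f_equal.
- exact (plus_opp_r (G := B) _).
- f_equal; exact (opp_opp (G := B) _).
Qed.

Lemma plus_of_real_im (u : cplx B) :
  u = plus (of_real (cplx_re u)) (Cplx zero (cplx_im u)).
Proof.
change (u = cplx_plus (of_real (cplx_re u)) (Cplx zero (cplx_im u))).
destruct u; unfold cplx_plus, of_real; simpl.
rewrite plus_zero_r, plus_zero_l; reflexivity.
Qed.

End ComplexVectorSpace.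

Arguments cplx_conj {B} u.
Arguments of_real {B} x.

Record complexification_norm (B : NormedModule R_AbsRing) : Type := {
  cplx_norm :> cplx B -> R;
  cplx_norm_triangle :
    forall u v, cplx_norm (plus u v) <= cplx_norm u + cplx_norm v;
  cplx_norm_scal :
    forall (c : C) u, cplx_norm (scal c u) = Cmod c * cplx_norm u;
  cplx_norm_eq_zero : forall u, cplx_norm u = 0 -> u = zero;
  cplx_norm_of_real : forall x : B, cplx_norm (of_real x) = norm x;
  cplx_norm_conj : forall u, cplx_norm (cplx_conj u) = cplx_norm u
}.

(* Completeness is not a field of [complexification_norm]: it follows from
   that of B, since max(|x|, |y|) <= |x + iy| <= |x| + |y|. *)
Section Complexification.

Variables (B : CompleteNormedModule R_AbsRing) (N : complexification_norm B).

Definition cplx_ball (u : cplx B) (e : R) (v : cplx B) : Prop :=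
  N (minus v u) < e.

Lemma cplx_norm_zero : N (cplx_zero B) = 0.
Proof.
transitivity (N (scal (RtoC 0) (cplx_zero B))).
- f_equal; symmetry; exact (scal_zero_l (V := cplx_ModuleSpace B) (cplx_zero B)).
- rewrite cplx_norm_scal, Cmod_0; ring.
Qed.

Lemma cplx_norm_opp u : N (opp u) = N u.
Proof.
transitivity (N (scal (- RtoC 1)%C u)).
- f_equal; symmetry; exact (scal_opp_one (V := cplx_ModuleSpace B) u).
- rewrite cplx_norm_scal, Cmod_m1; ring.
Qed.

Lemma cplx_ball_center (u : cplx B) (e : posreal) : cplx_ball u e u.
Proof.
unfold cplx_ball.
replace (minus u u) with (cplx_zero B).
- rewrite cplx_norm_zero; apply cond_pos.
- symmetry; exact (minus_eq_zero (G := cplx_AbelianGroup B) u).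
Qed.

Lemma cplx_ball_sym (u v : cplx B) (e : R) :
  cplx_ball u e v -> cplx_ball v e u.
Proof.
unfold cplx_ball; intros H.
replace (minus u v) with (opp (minus v u)).
- rewrite cplx_norm_opp; exact H.
- exact (opp_minus (G := cplx_AbelianGroup B) v u).
Qed.

Lemma cplx_ball_triangle (u v w : cplx B) (e1 e2 : R) :
  cplx_ball u e1 v -> cplx_ball v e2 w -> cplx_ball u (e1 + e2) w.
Proof.
unfold cplx_ball; intros H1 H2.
replace (minus w u) with (plus (minus w v) (minus v u)).
- apply Rle_lt_trans with (1 := cplx_norm_triangle _ N _ _); lra.
- symmetry; exact (minus_trans (G := cplx_AbelianGroup B) v w u).
Qed.

Definition cplx_UniformSpace_mixin :=
  UniformSpace.Mixin (cplx B) zero cplx_ball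
    cplx_ball_center cplx_ball_sym cplx_ball_triangle.

Definition cplx_UniformSpace :=
  UniformSpace.Pack (cplx B) cplx_UniformSpace_mixin (cplx B).

Definition cplx_NormedModuleAux :=
  NormedModuleAux.Pack C_AbsRing (cplx B)
    (NormedModuleAux.Class C_AbsRing (cplx B)
       (ModuleSpace.class C_Ring (cplx_ModuleSpace B))
       cplx_UniformSpace_mixin)
    (cplx B).

Lemma cplx_norm_scal_le (c : C_AbsRing) (u : cplx B) :
  N (scal c u) <= abs c * N u.
Proof. apply Req_le, cplx_norm_scal. Qed.

Lemma cplx_norm_compat1 (u v : cplx B) (e : R) :
  N (minus v u) < e -> cplx_ball u e v.
Proof. intros H; exact H. Qed.

Lemma cplx_norm_compat2 (u v : cplx B) (e : posreal) :
  cplx_ball u e v -> N (minus v u) < 1 * e.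
Proof. rewrite Rmult_1_l; intros H; exact H. Qed.

Definition cplx_NormedModule_mixin :=
  NormedModule.Mixin C_AbsRing cplx_NormedModuleAux N 1
    (cplx_norm_triangle _ N) cplx_norm_scal_le
    cplx_norm_compat1 cplx_norm_compat2 (cplx_norm_eq_zero _ N).

Definition cplx_NormedModule_class :=
  NormedModule.Class C_AbsRing (cplx B)
    (NormedModuleAux.class C_AbsRing cplx_NormedModuleAux)
    cplx_NormedModule_mixin.

Lemma cplx_norm_i_of_real (y : B) : N (Cplx zero y) = norm y.
Proof.
transitivity (N (scal Ci (of_real y))).
- f_equal; symmetry; exact (scal_Ci_of_real B y).
- rewrite cplx_norm_scal, Cmod_Ci, cplx_norm_of_real; ring.
Qed.

Lemma norm_scal_2_ge (x : B) : 2 * norm x <= norm (scal 2 x).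
Proof.
pose proof (norm_scal (/ 2) (scal 2 x)) as H.
rewrite scal_assoc in H.
change (norm (scal (/ 2 * 2) x) <= Rabs (/ 2) * norm (scal 2 x)) in H.
rewrite Rabs_pos_eq in H by lra.
replace (/ 2 * 2) with 1 in H by field.
change 1 with (@one R_Ring) in H; rewrite scal_one in H; lra.
Qed.

Lemma norm_re_le (u : cplx B) : norm (cplx_re u) <= N u.
Proof.
assert (H : norm (scal 2 (cplx_re u)) <= N u + N (cplx_conj u)).
{ rewrite <- (cplx_norm_of_real _ N).
  apply Rle_trans with (2 := cplx_norm_triangle _ N _ _), Req_le; f_equal.
  symmetry; exact (plus_conj B u). }
pose proof (norm_scal_2_ge (cplx_re u)); rewrite cplx_norm_conj in H; lra.
Qed.

Lemma norm_im_le (u : cplx B) : norm (cplx_im u) <= N u.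
Proof.
assert (H : norm (scal 2 (cplx_im u)) <= N u + N (opp (cplx_conj u))).
{ rewrite <- cplx_norm_i_of_real.
  apply Rle_trans with (2 := cplx_norm_triangle _ N _ _), Req_le; f_equal.
  symmetry; exact (minus_conj B u). }
pose proof (norm_scal_2_ge (cplx_im u)).
rewrite cplx_norm_opp, cplx_norm_conj in H; lra.
Qed.

Lemma cplx_norm_le (u : cplx B) :
  N u <= norm (cplx_re u) + norm (cplx_im u).
Proof.
rewrite <- (cplx_norm_of_real _ N), <- cplx_norm_i_of_real.
apply Rle_trans with (2 := cplx_norm_triangle _ N _ _), Req_le; f_equal.
exact (plus_of_real_im B u).
Qed.

Definition cplx_lim (F : (cplx B -> Prop) -> Prop) : cplx B :=
  Cplx (lim (filtermap cplx_re F)) (lim (filtermap cplx_im F)).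

Lemma cplx_lim_cauchy (F : (cplx B -> Prop) -> Prop) :
  ProperFilter F -> cauchy (T := cplx_UniformSpace) F ->
  forall e : posreal, F (cplx_ball (cplx_lim F) e).
Proof.
intros PF CF e.
assert (Cre : cauchy (filtermap cplx_re F)).
{ intros d; destruct (CF d) as [u Hu]; exists (cplx_re u).
  unfold filtermap; apply filter_imp with (2 := Hu); intros v Hv.
  apply (norm_compat1 (V := B)), Rle_lt_trans with (2 := Hv), (norm_re_le (minus v u)). }
assert (Cim : cauchy (filtermap cplx_im F)).
{ intros d; destruct (CF d) as [u Hu]; exists (cplx_im u).
  unfold filtermap; apply filter_imp with (2 := Hu); intros v Hv.
  apply (norm_compat1 (V := B)), Rle_lt_trans with (2 := Hv), (norm_im_le (minus v u)). }
pose proof (norm_factor_gt_0 (V := B)) as Kpos.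
set (K := @norm_factor R_AbsRing B) in *.
assert (dpos : 0 < e / (2 * K)).
{ apply Rdiv_lt_0_compat; [apply cond_pos | lra]. }
pose (d := mkposreal _ dpos).
assert (dE : K * d = e / 2) by (simpl; field; lra).
pose proof (complete_cauchy _ (filtermap_proper_filter _ _ _ _ PF) Cre d) as Hre.
pose proof (complete_cauchy _ (filtermap_proper_filter _ _ _ _ PF) Cim d) as Him.
unfold filtermap at 1 in Hre; unfold filtermap at 1 in Him.
apply filter_imp with (2 := filter_and (F := F) _ _ Hre Him).
intros v [H1 H2].
apply (norm_compat2 (V := B)) in H1; apply (norm_compat2 (V := B)) in H2.
fold K in H1, H2.
unfold cplx_ball.
apply Rle_lt_trans with (1 := cplx_norm_le _).
change (norm (minus (cplx_re v) (lim (filtermap cplx_re F)))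
        + norm (minus (cplx_im v) (lim (filtermap cplx_im F))) < e).
replace (pos e) with (K * d + K * d) by lra.
exact (Rplus_lt_compat _ _ _ _ H1 H2).
Qed.

Lemma cplx_lim_ext (F1 F2 : (cplx B -> Prop) -> Prop) :
  filter_le F1 F2 -> filter_le F2 F1 ->
  close (M := cplx_UniformSpace) (cplx_lim F1) (cplx_lim F2).
Proof.
intros H12 H21 e.
replace (cplx_lim F2) with (cplx_lim F1); [apply cplx_ball_center |].
unfold cplx_lim; f_equal; apply (eq_close (V := B)), (close_lim (T := B));
  intros P; unfold filtermap; first [apply H12 | apply H21].
Qed.

Definition cplx_CompleteSpace_mixin :=
  CompleteSpace.Mixin cplx_UniformSpace cplx_lim cplx_lim_cauchy cplx_lim_ext.

Definition complexification : CompleteNormedModule C_AbsRing :=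
  CompleteNormedModule.Pack C_AbsRing (cplx B)
    (CompleteNormedModule.Class C_AbsRing (cplx B)
       cplx_NormedModule_class cplx_CompleteSpace_mixin)
    (cplx B).

End Complexification.

Arguments complexification {B} N.

Definition exp_decreasing {B : NormedModule R_AbsRing} (f : nat -> B) : Prop :=
  forall n : nat,
    ex_series (V := R_NormedModule)
      (fun k => norm (f k) * exp (INR k * INR n)).

Section PowerSeries.

Variables (B : CompleteNormedModule R_AbsRing) (N : complexification_norm B).

Definition coeffs (a : nat -> B) : nat -> complexification N :=
  fun k => of_real (a k).

Definition represents (a : nat -> B) (f : C -> complexification N) : Prop :=
  forall z : C, is_pseries (K := C_AbsRing) (coeffs a) z (f z).

Definition entire (f : C -> complexification N) : Prop :=
  forall z : C, ex_derive (K := C_AbsRing) f z.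

Definition conj_symmetric (f : C -> complexification N) : Prop :=
  forall z : C, cplx_conj (f z) = f (Cconj z).

End PowerSeries.

Arguments coeffs {B} N a.
Arguments represents {B} N a f.
Arguments entire {B} N f.
Arguments conj_symmetric {B} N f.

(* Main.v *)
Require Import Defs.
From Stdlib Require Import Reals Lra Lia ClassicalEpsilon.
From Coquelicot Require Import Coquelicot.

(** An entire function f with values in a complex Banach space has an everywhere
    convergent Taylor series. In the logarithmic coordinate w = s + it, the
    integral of a 2 pi i-periodic holomorphic function G over [0, 2 pi] in t does
    not depend on s, by Goursat's theorem for rectangles: the horizontal sides
    cancel by periodicity. For G(w) = e^(-kw) f(e^w) this makes the coefficient
    c_k independent of the radius. With h(z) = (f(z) - f(z0)) / (z - z0), the
    integral of e^w h(e^w) vanishes, because it tends to 0 as s tends to -oo; the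
    partial sums of the series of c_k z0^k then telescope to f(z0) minus an
    integral of h against (z0 e^(-w))^n, which tends to 0 on a large circle.
    Uniqueness of the coefficients turns the conjugation symmetry of f into
    c_k being real, and the Cauchy bounds on all circles give the exponential
    decrease. *)

(** Only complex differentiability at each point is given, with no continuity of the derivative, so
    differentiation under the integral is out of reach and Goursat's bisection takes its place. In
    the coordinate w a circle around 0 is a segment of one period, so rectangles are the only
    contours, and neither winding numbers nor integrals along general curves occur. The factor e^w
    in e^w h(e^w) is the Jacobian of dz = z dw; since h is bounded near 0, it is also what forces
    the decay as s tends to -oo. The obstacle is the point z0: h is continuous there, but its
    differentiability there is not known before the expansion is proved. Goursat therefore applies
    only on either side of the line Re w = ln |z0|, and the line is crossed by continuity of the
    integral in s. *)

(* The square-zero extension C + V is a commutative ring containing both the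
   scalars and the vectors, so [ring] proves the identities of the module V. *)
Section ModuleIdentities.

Variable V : ModuleSpace C_Ring.

Definition sqz : Type := (C * V)%type.

Definition sqz_add (p q : sqz) : sqz := (Cplus (fst p) (fst q), plus (snd p) (snd q)).
Definition sqz_mul (p q : sqz) : sqz :=
  (Cmult (fst p) (fst q), plus (scal (fst p) (snd q)) (scal (fst q) (snd p))).
Definition sqz_opp (p : sqz) : sqz := (Copp (fst p), opp (snd p)).
Definition sqz_scalar (c : C) : sqz := (c, zero).
Definition sqz_vector (v : V) : sqz := (RtoC 0, v).

Lemma sqz_ring_theory :
  ring_theory (sqz_scalar 0) (sqz_scalar 1) sqz_add sqz_mul
    (fun p q => sqz_add p (sqz_opp q)) sqz_opp eq.
Proof.
split; intros; repeat match goal with p : sqz |- _ => destruct p end;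
  unfold sqz_add, sqz_mul, sqz_opp, sqz_scalar; cbn [fst snd]; f_equal; try ring.
- apply plus_zero_l.
- apply plus_comm.
- apply plus_assoc.
- rewrite scal_zero_r, plus_zero_r; exact (scal_one _).
- apply plus_comm.
- rewrite !scal_distr_l, !scal_assoc, <- plus_assoc.
  apply f_equal2; [|apply f_equal2]; apply (f_equal (fun x : C => scal x _)); cbn; ring.
- match goal with |- context [Cplus ?a ?b] => change (Cplus a b) with (@plus C_Ring a b) end.
  rewrite scal_distr_l, scal_distr_r, <- !plus_assoc.
  f_equal; rewrite !plus_assoc; f_equal; apply plus_comm.
- exact (plus_opp_r _).
Qed.

Lemma sqz_vector_inj u v : sqz_vector u = sqz_vector v -> u = v.
Proof. intros H; injection H; easy. Qed.

Lemma sqz_vector_plus u v : sqz_vector (plus u v) = sqz_add (sqz_vector u) (sqz_vector v).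
Proof. unfold sqz_vector, sqz_add; cbn [fst snd]; f_equal; ring. Qed.

Lemma sqz_vector_opp u : sqz_vector (opp u) = sqz_opp (sqz_vector u).
Proof. unfold sqz_vector, sqz_opp; cbn [fst snd]; f_equal; ring. Qed.

Lemma sqz_vector_scal c u : sqz_vector (scal c u) = sqz_mul (sqz_scalar c) (sqz_vector u).
Proof.
unfold sqz_vector, sqz_mul, sqz_scalar; cbn [fst snd]; f_equal; [ring|].
rewrite scal_zero_r, plus_zero_r; reflexivity.
Qed.

Lemma sqz_scalar_plus a b : sqz_scalar (Cplus a b) = sqz_add (sqz_scalar a) (sqz_scalar b).
Proof. unfold sqz_scalar, sqz_add; cbn [fst snd]; f_equal; rewrite plus_zero_r; easy. Qed.

Lemma sqz_scalar_opp a : sqz_scalar (Copp a) = sqz_opp (sqz_scalar a).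
Proof. unfold sqz_scalar, sqz_opp; cbn [fst snd]; f_equal; symmetry; exact (opp_zero (G := V)). Qed.

Lemma sqz_scalar_mult a b : sqz_scalar (Cmult a b) = sqz_mul (sqz_scalar a) (sqz_scalar b).
Proof.
unfold sqz_scalar, sqz_mul; cbn [fst snd]; f_equal.
rewrite !scal_zero_r, plus_zero_r; easy.
Qed.

End ModuleIdentities.

(** Both sides are embedded by the injective [sqz_vector] and the embedding is pushed down to the
    atoms, where [ring] applies. The second pass over [RtoC] reaches sums lying below a product or
    an opposite. *)
Ltac module_ring V :=
  apply (sqz_vector_inj V); unfold minus, Rminus, Cminus;
  rewrite ?RtoC_plus, ?RtoC_mult, ?RtoC_opp;
  rewrite ?RtoC_plus, ?RtoC_mult, ?RtoC_opp;
  repeat first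
    [ rewrite (sqz_vector_plus V) | rewrite (sqz_vector_opp V)
    | rewrite (sqz_vector_scal V)
    | match goal with |- context [sqz_vector ?W (@zero ?G)] =>
        change (sqz_vector W (@zero G)) with (sqz_scalar V (RtoC 0)) end
    | rewrite (sqz_scalar_plus V) | rewrite (sqz_scalar_opp V)
    | rewrite (sqz_scalar_mult V) ];
  ring.

(** * Integration in a complex Banach space *)

Section Integral.

Variable V : CompleteNormedModule C_AbsRing.

Add Ring sqz_ring : (sqz_ring_theory V).

(* Coquelicot's [RInt] needs a real normed module: restrict the scalars of V. *)
Definition real_scal (r : R) (v : V) : V := scal (RtoC r) v.

Lemma real_scal_assoc (x y : R_Ring) u : real_scal x (real_scal y u) = real_scal (mult x y) u.
Proof. unfold real_scal; change (mult x y) with (x * y)%R; module_ring V. Qed.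
Lemma real_scal_one u : real_scal (@one R_Ring) u = u.
Proof. exact (scal_one u). Qed.
Lemma real_scal_distr_l (x : R_Ring) (u v : V) :
  real_scal x (plus u v) = plus (real_scal x u) (real_scal x v).
Proof. exact (scal_distr_l (RtoC x) u v). Qed.
Lemma real_scal_distr_r (x y : R_Ring) u :
  real_scal (plus x y) u = plus (real_scal x u) (real_scal y u).
Proof. unfold real_scal; change (plus x y) with (x + y)%R; module_ring V. Qed.

Definition real_ModuleSpace_mixin :=
  ModuleSpace.Mixin R_Ring (CompleteNormedModule.AbelianGroup _ V) real_scal
    real_scal_assoc real_scal_one real_scal_distr_l real_scal_distr_r.

Definition real_NormedModuleAux :=
  NormedModuleAux.Pack R_AbsRing V
    (NormedModuleAux.Class R_AbsRing V
       (ModuleSpace.Class R_Ring V _ real_ModuleSpace_mixin)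
       (UniformSpace.class (CompleteNormedModule.UniformSpace _ V))) V.

Lemma real_norm_scal (r : R_AbsRing) (v : V) : norm (real_scal r v) <= abs r * norm v.
Proof.
change (abs r) with (Rabs r); rewrite <- Cmod_R.
exact (norm_scal (RtoC r) v).
Qed.

Definition real_NormedModule_mixin :=
  NormedModule.Mixin R_AbsRing real_NormedModuleAux (fun v : V => norm v)
    (@norm_factor C_AbsRing V) (@norm_triangle C_AbsRing V) real_norm_scal
    (@norm_compat1 C_AbsRing V) (@norm_compat2 C_AbsRing V) (@norm_eq_zero C_AbsRing V).

(** Carrier, uniform structure and norm are those of [V], so continuity, norm bounds and
    completeness carry over by conversion. *)
Definition real_CompleteNormedModule : CompleteNormedModule R_AbsRing :=
  CompleteNormedModule.Pack R_AbsRing V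
    (CompleteNormedModule.Class R_AbsRing V
       (NormedModule.Class R_AbsRing V _ real_NormedModule_mixin)
       (CompleteNormedModule.mixin _ _ (CompleteNormedModule.class _ V))) V.

Definition CInt (f : R -> V) (a b : R) : V := RInt (V := real_CompleteNormedModule) f a b.

Lemma ex_CInt (f : R -> V) a b : (forall t, continuous f t) ->
  ex_RInt (V := real_CompleteNormedModule) f a b.
Proof. intros H; apply ex_RInt_continuous; intros t _; exact (H t). Qed.

Lemma CInt_ext (f g : R -> V) a b : (forall t, f t = g t) -> CInt f a b = CInt g a b.
Proof. intros H; apply (RInt_ext (V := real_CompleteNormedModule)); intros t _; apply H. Qed.

Lemma CInt_plus (f g : R -> V) a b :
  (forall t, continuous f t) -> (forall t, continuous g t) ->
  CInt (fun t => plus (f t) (g t)) a b = plus (CInt f a b) (CInt g a b).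
Proof. intros Hf Hg; apply (RInt_plus (V := real_CompleteNormedModule)); apply ex_CInt; assumption. Qed.

Lemma CInt_Chasles (f : R -> V) a b c : (forall t, continuous f t) ->
  plus (CInt f a b) (CInt f b c) = CInt f a c.
Proof. intros H; apply (RInt_Chasles (V := real_CompleteNormedModule)); apply ex_CInt, H. Qed.

Lemma CInt_const (v : V) a b : CInt (fun _ => v) a b = scal (RtoC (b - a)) v.
Proof. apply (RInt_const (V := real_CompleteNormedModule)). Qed.

(** The integral is built over real scalars; complex linearity is checked on Riemann sums and passes
    to the limit because multiplication by [c] is continuous. *)
Lemma Riemann_sum_complex_scal (c : C) (f : R -> V) ptd :
  Riemann_sum (V := real_CompleteNormedModule) (fun t => scal c (f t)) ptd
  = scal c (Riemann_sum (V := real_CompleteNormedModule) f ptd).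
Proof.
induction ptd as [x0 | h s IH] using SF_cons_ind.
- symmetry; exact (scal_zero_r (V := V) c).
- rewrite 2!(Riemann_sum_cons (V := real_CompleteNormedModule)), IH.
  set (S := Riemann_sum _ _).
  change (plus (real_scal (SF_h s - fst h) (scal c (f (snd h)))) (scal c (S : V))
    = scal c (plus (real_scal (SF_h s - fst h) (f (snd h))) (S : V))).
  unfold real_scal; generalize (S : V) (f (snd h)); intros u w; module_ring V.
Qed.

Lemma CInt_scal (c : C) (f : R -> V) a b : (forall t, continuous f t) ->
  CInt (fun t => scal c (f t)) a b = scal c (CInt f a b).
Proof.
intros Hf; apply (is_RInt_unique (V := real_CompleteNormedModule)).
pose proof (RInt_correct _ _ _ (ex_CInt f a b Hf)) as H; unfold is_RInt in *.
apply filterlim_ext with (f := fun ptd => scal c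
  (scal (sign (b - a)) (Riemann_sum (V := real_CompleteNormedModule) f ptd) : V)).
- intros ptd; rewrite Riemann_sum_complex_scal.
  generalize (Riemann_sum (V := real_CompleteNormedModule) f ptd : V); intros u.
  change (scal c (real_scal (sign (b - a)) u) = real_scal (sign (b - a)) (scal c u)).
  unfold real_scal; module_ring V.
- apply (filterlim_comp _ _ _ _ _ _ _ _ H).
  exact (filterlim_scal_r (V := V) c _).
Qed.

Lemma CInt_minus (f g : R -> V) a b :
  (forall t, continuous f t) -> (forall t, continuous g t) ->
  CInt (fun t => minus (f t) (g t)) a b = minus (CInt f a b) (CInt g a b).
Proof.
intros Hf Hg; apply (RInt_minus (V := real_CompleteNormedModule)); apply ex_CInt; assumption.
Qed.

Lemma CInt_norm (f : R -> V) a b M : (forall t, continuous f t) -> a <= b ->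
  (forall t, a <= t <= b -> norm (f t) <= M) -> norm (CInt f a b) <= (b - a) * M.
Proof.
intros Hf Hab HM.
exact (norm_RInt_le_const (V := real_CompleteNormedModule) f a b _ M Hab HM
  (RInt_correct _ _ _ (ex_CInt f a b Hf))).
Qed.

End Integral.

(** * Goursat's theorem for rectangles *)

Lemma Cmod_le_Rabs (x y : R) : Cmod (x, y) <= Rabs x + Rabs y.
Proof.
replace ((x, y) : C) with (RtoC x + RtoC y * Ci)%C
  by (apply injective_projections; cbn; ring).
apply Rle_trans with (1 := Cmod_triangle _ _).
rewrite Cmod_mult, Cmod_Ci, !Cmod_R; lra.
Qed.

(** The supremum of the left ends works, since [l n <= l (n + m) <= r (n + m) <= r m]. *)
Lemma nested_segments (l r : nat -> R) :
  (forall n, l n <= l (S n)) -> (forall n, r (S n) <= r n) -> (forall n, l n <= r n) ->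
  exists u, forall n, l n <= u <= r n.
Proof.
intros Hl Hr Hlr.
assert (Hl' : forall n k, l n <= l (n + k)%nat).
{ intros n k; induction k as [|k IH]; [rewrite Nat.add_0_r; lra|].
  rewrite Nat.add_succ_r; specialize (Hl (n + k)%nat); lra. }
assert (Hr' : forall n k, r (n + k)%nat <= r n).
{ intros n k; induction k as [|k IH]; [rewrite Nat.add_0_r; lra|].
  rewrite Nat.add_succ_r; specialize (Hr (n + k)%nat); lra. }
assert (H : forall n m, l n <= r m).
{ intros n m; specialize (Hl' n m); specialize (Hr' m n); specialize (Hlr (n + m)%nat).
  rewrite (Nat.add_comm m n) in Hr'; lra. }
destruct (completeness (fun x => exists n, x = l n)) as [u [Hu1 Hu2]].
- exists (r 0%nat); intros x [n ->]; apply H.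
- exists (l 0%nat), 0%nat; reflexivity.
- exists u; intros n; split; [apply Hu1; exists n; reflexivity|].
  apply Hu2; intros x [m ->]; apply H.
Qed.

(** [P x y h] speaks of the cell with corner [(x, y)] and sides [h * L], [h * M]. A bad cell has a
    bad quarter, so a bad start yields nested bad cells shrinking to a point, where the local
    hypothesis contradicts them. That hypothesis concerns only cells containing the point, which is
    all that a derivative there controls. *)
Lemma bisection_2d (P : R -> R -> R -> Prop) (L M X Y : R) : 0 < L -> 0 < M ->
  (forall x y h, 0 < h ->
     P x y (h / 2) -> P (x + h / 2 * L) y (h / 2) ->
     P x (y + h / 2 * M) (h / 2) -> P (x + h / 2 * L) (y + h / 2 * M) (h / 2) ->
     P x y h) ->
  (forall u v, X <= u <= X + L -> Y <= v <= Y + M ->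
     exists delta, 0 < delta /\ forall x y h, 0 < h < delta ->
       x <= u <= x + h * L -> y <= v <= y + h * M -> P x y h) ->
  P X Y 1.
Proof.
intros HL HM Hsplit Hloc; apply NNPP; intros HP.
pose (h := fun n => (/ 2) ^ n).
assert (Hh : forall n, 0 < h n) by (intros n; apply pow_lt; lra).
assert (HS : forall n, h (S n) = h n / 2) by (intros n; unfold h; cbn; field).
(* The badness of [p] is a premise below the existential, so that choice yields a total function
   [next]. *)
assert (Hnext : forall (n : nat) (p : R * R), exists q : R * R,
  ~ P (fst p) (snd p) (h n) -> ~ P (fst q) (snd q) (h (S n)) /\
  fst p <= fst q <= fst p + h n / 2 * L /\ snd p <= snd q <= snd p + h n / 2 * M).
{ intros n [x y]; cbn [fst snd]; rewrite HS; specialize (Hh n).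
  assert (0 < h n / 2 * L) by (apply Rmult_lt_0_compat; lra).
  assert (0 < h n / 2 * M) by (apply Rmult_lt_0_compat; lra).
  destruct (classic (P x y (h n / 2))) as [H1|H1]; [|exists (x, y); cbn; repeat split; auto; lra].
  destruct (classic (P (x + h n / 2 * L) y (h n / 2))) as [H2|H2];
    [|exists (x + h n / 2 * L, y); cbn; repeat split; auto; lra].
  destruct (classic (P x (y + h n / 2 * M) (h n / 2))) as [H3|H3];
    [|exists (x, y + h n / 2 * M); cbn; repeat split; auto; lra].
  exists (x + h n / 2 * L, y + h n / 2 * M); cbn; intros H4; repeat split; try lra.
  intros H5; apply H4, Hsplit; auto. }
pose (next := fun n p => proj1_sig (constructive_indefinite_description _ (Hnext n p))).
assert (Hn : forall n p, ~ P (fst p) (snd p) (h n) ->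
  ~ P (fst (next n p)) (snd (next n p)) (h (S n)) /\
  fst p <= fst (next n p) <= fst p + h n / 2 * L /\
  snd p <= snd (next n p) <= snd p + h n / 2 * M)
  by (intros n p; exact (proj2_sig (constructive_indefinite_description _ (Hnext n p)))).
pose (s := fix s n := match n with O => (X, Y) | S n => next n (s n) end).
assert (Hs : forall n, ~ P (fst (s n)) (snd (s n)) (h n)).
{ induction n as [|n IH]; [exact HP | apply Hn, IH]. }
destruct (nested_segments (fun n => fst (s n)) (fun n => fst (s n) + h n * L)) as [u Hu].
{ intros n; apply (Hn n (s n)), Hs. }
{ intros n; rewrite HS; pose proof (proj1 (proj2 (Hn n (s n) (Hs n)))); cbn [s] in *.
  specialize (Hh n); nra. }
{ intros n; specialize (Hh n); nra. }
destruct (nested_segments (fun n => snd (s n)) (fun n => snd (s n) + h n * M)) as [v Hv].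
{ intros n; apply (Hn n (s n)), Hs. }
{ intros n; rewrite HS; pose proof (proj2 (proj2 (Hn n (s n) (Hs n)))); cbn [s] in *.
  specialize (Hh n); nra. }
{ intros n; specialize (Hh n); nra. }
destruct (Hloc u v) as [delta [Hd H]].
{ generalize (Hu 0%nat); cbn; lra. }
{ generalize (Hv 0%nat); cbn; lra. }
destruct (pow_lt_1_zero (/ 2)) with (y := delta) as [n Hlt]; auto.
{ rewrite Rabs_pos_eq; lra. }
apply (Hs n), H; [split; [apply Hh|]|apply Hu|apply Hv].
specialize (Hlt n (le_n n)); rewrite Rabs_pos_eq in Hlt; [exact Hlt|].
apply Rlt_le, Hh.
Qed.

(** * Epsilon-delta criteria for continuity and complex derivatives *)

Section Epsilon.

Variable V : NormedModule C_AbsRing.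

Lemma continuous_C_iff (F : C -> V) (z : C) :
  continuous (T := AbsRing_UniformSpace C_AbsRing) F z <->
  forall eps, 0 < eps -> exists delta, 0 < delta /\
    forall w : C, Cmod (w - z) < delta -> norm (minus (F w) (F z)) < eps.
Proof.
pose proof (norm_factor_gt_0 (V := V)) as HK.
split; intros H.
- intros eps Heps.
  (* Uniform balls and norm balls agree only up to [norm_factor]. *)
  assert (He : 0 < eps / norm_factor (V := V)) by (apply Rdiv_lt_0_compat; assumption).
  destruct (proj1 (filterlim_locally _ _) H (mkposreal _ He)) as [d Hd].
  exists d; split; [apply cond_pos|]; intros w Hw.
  pose proof (norm_compat2 _ _ _ (Hd w Hw)) as Hn; cbn in Hn.
  replace eps with (norm_factor (V := V) * (eps / norm_factor (V := V))) by (field; lra).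
  exact Hn.
- apply filterlim_locally; intros eps.
  destruct (H eps (cond_pos eps)) as [d [Hd Hw]].
  exists (mkposreal d Hd); intros w Hwz; apply norm_compat1, Hw, Hwz.
Qed.

Lemma is_derive_C_iff (F : C -> V) (z : C) (l : V) :
  is_derive (K := C_AbsRing) F z l <->
  forall eps, 0 < eps -> exists delta, 0 < delta /\
    forall w : C, Cmod (w - z) < delta ->
      norm (minus (minus (F w) (F z)) (scal (w - z)%C l)) <= eps * Cmod (w - z).
Proof.
split.
- intros [_ H] eps Heps.
  destruct (H z (fun P HP => HP) (mkposreal eps Heps)) as [d Hd].
  exists d; split; [apply cond_pos|]; intros w Hw; exact (Hd w Hw).
- intros H; split; [exact (is_linear_scal_l l)|].
  intros x Hx; rewrite <- (is_filter_lim_locally_unique (V := AbsRing_NormedModule C_AbsRing) _ _ Hx).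
  intros eps; destruct (H eps (cond_pos eps)) as [d [Hd Hw]].
  exists (mkposreal d Hd); intros w Hwz; exact (Hw w Hwz).
Qed.

Lemma continuous_path (F : C -> V) (g : R -> C) (k : R) (t : R) :
  (forall s, Cmod (g s - g t) <= k * Rabs (s - t)) ->
  continuous (T := AbsRing_UniformSpace C_AbsRing) F (g t) ->
  continuous (fun s => F (g s)) t.
Proof.
intros Hg HF.
apply (continuous_comp (V := AbsRing_UniformSpace C_AbsRing) g F); [|exact HF].
apply filterlim_locally; intros eps.
assert (Hd : 0 < eps / (Rabs k + 1))
  by (apply Rdiv_lt_0_compat; [apply cond_pos | pose proof (Rabs_pos k); lra]).
exists (mkposreal _ Hd); intros s Hs.
change (Rabs (s - t) < eps / (Rabs k + 1)) in Hs.
change (Cmod (g s - g t) < eps).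
apply Rle_lt_trans with (1 := Hg s).
apply Rle_lt_trans with (Rabs (s - t) * (Rabs k + 1)).
- pose proof (Rle_abs k); pose proof (Rabs_pos (s - t)); nra.
- apply (Rmult_lt_compat_r (Rabs k + 1)) in Hs; [|pose proof (Rabs_pos k); lra].
  replace (eps / (Rabs k + 1) * (Rabs k + 1)) with (pos eps) in Hs; [exact Hs|].
  field; pose proof (Rabs_pos k); lra.
Qed.

Lemma norm_minus_le (u v : V) : norm (minus u v) <= norm u + norm v.
Proof.
apply Rle_trans with (1 := norm_triangle _ _); rewrite norm_opp; lra.
Qed.

End Epsilon.

Section Goursat.

Variable V : CompleteNormedModule C_AbsRing.

Add Ring sqz_ring : (sqz_ring_theory V).

Notation Ccontinuous := (continuous (T := AbsRing_UniformSpace C_AbsRing)).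

Lemma Ccontinuous_const (u : V) w : Ccontinuous (fun _ => u) w.
Proof. apply (continuous_const (U := AbsRing_UniformSpace C_AbsRing)). Qed.

Lemma Ccontinuous_plus (F G : C -> V) w :
  Ccontinuous F w -> Ccontinuous G w -> Ccontinuous (fun w => plus (F w) (G w)) w.
Proof. exact (continuous_plus (U := AbsRing_UniformSpace C_AbsRing) (V := V) F G w). Qed.

Lemma Ccontinuous_minus (F G : C -> V) w :
  Ccontinuous F w -> Ccontinuous G w -> Ccontinuous (fun w => minus (F w) (G w)) w.
Proof. exact (continuous_minus (U := AbsRing_UniformSpace C_AbsRing) (V := V) F G w). Qed.

Lemma Ccontinuous_scal (k : C -> C) (F : C -> V) w :
  continuous (T := AbsRing_UniformSpace C_AbsRing) (U := AbsRing_UniformSpace C_AbsRing) k w ->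
  Ccontinuous F w -> Ccontinuous (fun w => scal (k w) (F w)) w.
Proof.
exact (continuous_scal (U := AbsRing_UniformSpace C_AbsRing) (K := C_AbsRing) (V := V) k F w).
Qed.

Lemma Ccontinuous_scal_id (l : V) w : Ccontinuous (fun w => scal w l) w.
Proof.
apply (Ccontinuous_scal (fun w => w)); [|apply Ccontinuous_const].
exact (continuous_id (U := AbsRing_UniformSpace C_AbsRing) w).
Qed.

Lemma continuous_hor (G : C -> V) (y t : R) : (forall w, Ccontinuous G w) ->
  continuous (fun s : R => G (s, y)) t.
Proof.
intros HG; apply (continuous_path V G (fun s => (s, y)) 1); [|apply HG].
intros s; replace ((s, y) - (t, y))%C with (RtoC (s - t))
  by (apply injective_projections; cbn; ring).
rewrite Cmod_R; lra.
Qed.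

Lemma continuous_ver (G : C -> V) (x t : R) : (forall w, Ccontinuous G w) ->
  continuous (fun s : R => G (x, s)) t.
Proof.
intros HG; apply (continuous_path V G (fun s => (x, s)) 1); [|apply HG].
intros s; replace ((x, s) - (x, t))%C with (RtoC (s - t) * Ci)%C
  by (apply injective_projections; cbn; ring).
rewrite Cmod_mult, Cmod_Ci, Cmod_R; lra.
Qed.

(** The contour integral of [G w dw] around the rectangle [[a, b] x [c, d]], counterclockwise; [Ci]
    comes from [dw = i dt] on the vertical sides. *)
Definition boundary_int (G : C -> V) (a b c d : R) : V :=
  plus (minus (CInt V (fun t => G (t, c)) a b) (CInt V (fun t => G (t, d)) a b))
    (scal Ci (minus (CInt V (fun t => G (b, t)) c d) (CInt V (fun t => G (a, t)) c d))).

Lemma boundary_int_split_h (G : C -> V) a m b c d : (forall w, Ccontinuous G w) ->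
  boundary_int G a b c d = plus (boundary_int G a m c d) (boundary_int G m b c d).
Proof.
intros HG; unfold boundary_int.
rewrite <- (CInt_Chasles V (fun t => G (t, c)) a m b) by (intros; apply continuous_hor, HG).
rewrite <- (CInt_Chasles V (fun t => G (t, d)) a m b) by (intros; apply continuous_hor, HG).
module_ring V.
Qed.

Lemma boundary_int_split_v (G : C -> V) a b c m d : (forall w, Ccontinuous G w) ->
  boundary_int G a b c d = plus (boundary_int G a b c m) (boundary_int G a b m d).
Proof.
intros HG; unfold boundary_int.
rewrite <- (CInt_Chasles V (fun t => G (a, t)) c m d) by (intros; apply continuous_ver, HG).
rewrite <- (CInt_Chasles V (fun t => G (b, t)) c m d) by (intros; apply continuous_ver, HG).
module_ring V.
Qed.

Lemma boundary_int_ext (F G : C -> V) a b c d : (forall w, F w = G w) ->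
  boundary_int F a b c d = boundary_int G a b c d.
Proof.
intros H; unfold boundary_int.
repeat match goal with |- context [CInt V (fun t => F (@?p t)) ?u ?v] =>
  rewrite (CInt_ext V (fun t => F (p t)) (fun t => G (p t)) u v) by (intros; apply H) end.
reflexivity.
Qed.

Lemma boundary_int_plus (F G : C -> V) a b c d :
  (forall w, Ccontinuous F w) -> (forall w, Ccontinuous G w) ->
  boundary_int (fun w => plus (F w) (G w)) a b c d
  = plus (boundary_int F a b c d) (boundary_int G a b c d).
Proof.
intros HF HG; unfold boundary_int.
rewrite !CInt_plus by (intros; (apply continuous_hor || apply continuous_ver); assumption).
module_ring V.
Qed.

(** The integrals [J] cancel between opposite sides and are never evaluated. What remains is
    [i (c - d) (b - a) l] from the horizontal sides and its opposite from the vertical ones. *)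
Lemma boundary_int_affine (u l : V) a b c d :
  boundary_int (fun w => plus u (scal w l)) a b c d = zero.
Proof.
rewrite boundary_int_plus; [|intros; apply Ccontinuous_const|intros; apply Ccontinuous_scal_id].
pose (J := CInt V (fun t => scal (RtoC t) l)).
assert (CJ : forall t, continuous (fun t : R => scal (RtoC t) l) t)
  by (intros t; exact (continuous_hor (fun w => scal w l) 0 t (Ccontinuous_scal_id l))).
assert (Hh : forall y p q, CInt V (fun t => scal ((t, y) : C) l) p q
  = plus (J p q) (scal (Ci * RtoC y * RtoC (q - p))%C l)).
{ intros y p q.
  rewrite CInt_ext with (g := fun t => plus (scal (RtoC t) l) (scal (Ci * RtoC y)%C l)).
  - rewrite CInt_plus by (auto; intros; apply continuous_const).
    rewrite CInt_const; unfold J; module_ring V.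
  - intros t; replace ((t, y) : C) with (RtoC t + Ci * RtoC y)%C
      by (apply injective_projections; cbn; ring).
    module_ring V. }
assert (Hv : forall x p q, CInt V (fun t => scal ((x, t) : C) l) p q
  = plus (scal Ci (J p q)) (scal (RtoC x * RtoC (q - p))%C l)).
{ intros x p q.
  rewrite CInt_ext with (g := fun t => plus (scal Ci (scal (RtoC t) l)) (scal (RtoC x) l)).
  - rewrite CInt_plus, CInt_const, CInt_scal
      by (auto; intros; try apply continuous_const;
          apply (continuous_scal_r (V := V)), CJ).
    unfold J; module_ring V.
  - intros t; replace ((x, t) : C) with (RtoC t * Ci + RtoC x)%C
      by (apply injective_projections; cbn; ring).
    module_ring V. }
unfold boundary_int; rewrite !Hh, !Hv, !CInt_const.
module_ring V.
Qed.

Lemma boundary_int_norm (G : C -> V) a b c d M :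
  (forall w, Ccontinuous G w) -> a <= b -> c <= d ->
  (forall x y, a <= x <= b -> c <= y <= d -> norm (G (x, y)) <= M) ->
  norm (boundary_int G a b c d) <= 2 * ((b - a) + (d - c)) * M.
Proof.
intros HG Hab Hcd HM; unfold boundary_int.
apply Rle_trans with (1 := norm_triangle (V := V) _ _).
apply Rle_trans with (((b - a) * M + (b - a) * M) + 1 * ((d - c) * M + (d - c) * M)); [|lra].
apply Rplus_le_compat.
- apply Rle_trans with (1 := norm_minus_le V _ _).
  apply Rplus_le_compat; apply CInt_norm; auto; intros; try (apply continuous_hor, HG);
    apply HM; lra.
- apply Rle_trans with (1 := norm_scal (V := V) _ _).
  change (abs Ci) with (Cmod Ci); rewrite Cmod_Ci.
  apply Rmult_le_compat_l; [lra|].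
  apply Rle_trans with (1 := norm_minus_le V _ _).
  apply Rplus_le_compat; apply CInt_norm; auto; intros; try (apply continuous_ver, HG);
    apply HM; lra.
Qed.

(** The bisected property bounds the integral by [eps * h ^ 2], a multiple of the area, so the
    bounds of the four quarters add up exactly. Differentiability is asked only on the closed
    rectangle, while continuity everywhere keeps all integrals defined. *)
Theorem goursat (G : C -> V) a b c d : a < b -> c < d ->
  (forall w, Ccontinuous G w) ->
  (forall x y, a <= x <= b -> c <= y <= d -> ex_derive (K := C_AbsRing) G (x, y)) ->
  boundary_int G a b c d = zero.
Proof.
intros Hab Hcd HG HD.
apply (norm_eq_zero (V := V)), Rle_antisym; [|apply norm_ge_0].
apply le_epsilon; intros eps Heps; rewrite Rplus_0_l.
set (L := b - a); set (M := d - c).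
assert (HL : 0 < L) by (unfold L; lra).
assert (HM : 0 < M) by (unfold M; lra).
enough (H : norm (boundary_int G a (a + 1 * L) c (c + 1 * M)) <= eps * 1 ^ 2).
{ replace (a + 1 * L) with b in H by (unfold L; ring).
  replace (c + 1 * M) with d in H by (unfold M; ring). lra. }
apply (bisection_2d (fun x y h =>
  norm (boundary_int G x (x + h * L) y (y + h * M)) <= eps * h ^ 2) L M a c HL HM).
- intros x y h Hh H1 H2 H3 H4.
  rewrite (boundary_int_split_h G x (x + h / 2 * L) (x + h * L)) by exact HG.
  rewrite (boundary_int_split_v G x _ y (y + h / 2 * M) (y + h * M)) by exact HG.
  rewrite (boundary_int_split_v G _ (x + h * L) y (y + h / 2 * M) (y + h * M)) by exact HG.
  replace (x + h / 2 * L + h / 2 * L) with (x + h * L) in * by field.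
  replace (y + h / 2 * M + h / 2 * M) with (y + h * M) in * by field.
  apply Rle_trans with (1 := norm_triangle (V := V) _ _).
  apply Rle_trans with (1 := Rplus_le_compat _ _ _ _ (norm_triangle (V := V) _ _) (norm_triangle (V := V) _ _)).
  replace (eps * h ^ 2) with
    (eps * (h / 2) ^ 2 + eps * (h / 2) ^ 2 + (eps * (h / 2) ^ 2 + eps * (h / 2) ^ 2)) by field.
  lra.
- intros u v Hu Hv; destruct (HD u v) as [l Hl]; [unfold L in *; lra|unfold M in *; lra|].
  (* A cell has perimeter [2 * h * (L + M)], and its points lie within [h * (L + M)] of [(u, v)];
     the product of the two, times [eps'], is [eps * h ^ 2]. *)
  set (eps' := eps / (2 * (L + M) ^ 2)).
  assert (Heps' : 0 < eps') by (apply Rdiv_lt_0_compat; nra).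
  destruct (proj1 (is_derive_C_iff V G (u, v) l) Hl eps' Heps') as [delta [Hd Hw]].
  exists (delta / (L + M)); split; [apply Rdiv_lt_0_compat; lra|].
  intros x y h [Hh Hhd] Hx Hy.
  assert (Hhd' : h * (L + M) < delta).
  { apply (Rmult_lt_compat_r (L + M)) in Hhd; [|lra].
    replace (delta / (L + M) * (L + M)) with delta in Hhd by (field; lra); lra. }
  pose (p := ((u, v) : C)).
  pose (r := (fun w => minus (minus (G w) (G p)) (scal (w - p)%C l)) : C -> V).
  assert (Hr : forall w, Ccontinuous r w).
  { intros w; unfold r; apply Ccontinuous_minus.
    - apply Ccontinuous_minus; [apply HG|apply Ccontinuous_const].
    - apply (continuous_ext (T := AbsRing_UniformSpace C_AbsRing) (U := V)
        (fun w : C => minus (scal w l) (scal p l))).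
      + intros z; module_ring V.
      + apply Ccontinuous_minus; [apply Ccontinuous_scal_id|apply Ccontinuous_const]. }
  (* The first-order expansion of [G] at [p] is affine and integrates to zero, so only the remainder
     [r] is left to bound. *)
  rewrite boundary_int_ext with
    (G := fun w => plus (plus (minus (G p) (scal p l)) (scal w l)) (r w)).
  2: { intros w; unfold r; module_ring V. }
  rewrite boundary_int_plus; [|intros w; apply Ccontinuous_plus;
    [apply Ccontinuous_const|apply Ccontinuous_scal_id]|exact Hr].
  rewrite boundary_int_affine, plus_zero_l.
  apply Rle_trans with (2 * ((x + h * L - x) + (y + h * M - y)) * (eps' * (h * (L + M)))).
  + apply boundary_int_norm; [exact Hr|nra|nra|].
    intros x' y' Hx' Hy'.
    assert (Hc : Cmod ((x', y') - p) <= h * (L + M)).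
    { replace ((x', y') - p)%C with ((x' - u, y' - v) : C)
        by (apply injective_projections; cbn; ring).
      apply Rle_trans with (1 := Cmod_le_Rabs _ _).
      rewrite Rmult_plus_distr_l; apply Rplus_le_compat; apply Rabs_le; lra. }
    apply Rle_trans with (1 := Hw (x', y') (Rle_lt_trans _ _ _ Hc Hhd')).
    apply Rmult_le_compat_l; [lra|exact Hc].
  + apply Req_le; unfold eps'; field; lra.
Qed.

End Goursat.

(** * The complex exponential *)

Definition cexp (w : C) : C := (exp (Re w) * cos (Im w), exp (Re w) * sin (Im w)).

Lemma cexp_plus v w : cexp (v + w) = (cexp v * cexp w)%C.
Proof.
destruct v as [a b], w as [c d]; unfold cexp; cbn.
rewrite exp_plus, cos_plus, sin_plus.
apply injective_projections; cbn; ring.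
Qed.

Lemma cexp_0 : cexp 0 = 1.
Proof.
unfold cexp; cbn; rewrite exp_0, cos_0, sin_0; apply injective_projections; cbn; ring.
Qed.

Lemma cexp_opp_l w : (cexp (- w) * cexp w)%C = 1.
Proof.
rewrite <- cexp_plus; replace (- w + w)%C with (RtoC 0) by ring; apply cexp_0.
Qed.

Lemma Cmod_cexp w : Cmod (cexp w) = exp (Re w).
Proof.
unfold Cmod, cexp; cbn [fst snd].
replace ((exp (Re w) * cos (Im w)) ^ 2 + (exp (Re w) * sin (Im w)) ^ 2) with (exp (Re w) ^ 2).
- apply sqrt_pow2, Rlt_le, exp_pos.
- transitivity (exp (Re w) ^ 2 * (Rsqr (sin (Im w)) + Rsqr (cos (Im w)))).
  + rewrite sin2_cos2; ring.
  + unfold Rsqr; ring.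
Qed.

Lemma cexp_period x : cexp (x, 2 * PI) = cexp (x, 0).
Proof. unfold cexp; cbn [Re Im fst snd]; rewrite cos_2PI, sin_2PI, cos_0, sin_0; reflexivity. Qed.

Lemma cexp_opp_period x : cexp (- (x, 2 * PI)) = cexp (- (x, 0)).
Proof.
unfold cexp; cbn -[PI]; rewrite !cos_neg, !sin_neg, cos_2PI, sin_2PI, cos_0, sin_0; reflexivity.
Qed.

Lemma derivable_pt_lim_0_estimate (f : R -> R) l eps : derivable_pt_lim f 0 l -> 0 < eps ->
  exists delta, 0 < delta /\ forall h, Rabs h < delta -> Rabs (f h - f 0 - l * h) <= eps * Rabs h.
Proof.
intros H Heps; destruct (H eps Heps) as [d Hd].
exists d; split; [apply cond_pos|]; intros h Hh.
destruct (Req_dec h 0) as [->|Hh0].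
- replace (f 0 - f 0 - l * 0) with 0 by ring; rewrite Rabs_R0; lra.
- specialize (Hd h Hh0 Hh); rewrite Rplus_0_l in Hd.
  replace (f h - f 0 - l * h) with (((f h - f 0) / h - l) * h) by (field; exact Hh0).
  rewrite Rabs_mult; apply Rmult_le_compat_r; [apply Rabs_pos|lra].
Qed.

Lemma cexp_estimate eps : 0 < eps -> exists delta, 0 < delta /\
  forall h, Cmod h < delta -> Cmod (cexp h - 1 - h) <= eps * Cmod h.
Proof.
(* The errors of the two components add up to [e |x| + 5 e |y|], hence the 6. The bound [e <= 1]
   keeps [exp x] below 2. *)
intros Heps; set (e := Rmin 1 (eps / 6)).
assert (He : 0 < e) by (unfold e; apply Rmin_pos; lra).
assert (He1 : e <= 1) by apply Rmin_l.
assert (He6 : 6 * e <= eps) by (pose proof (Rmin_r 1 (eps / 6)); fold e in H; lra).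
destruct (derivable_pt_lim_0_estimate exp 1 e) as [d1 [Hd1 H1]]; auto.
{ rewrite <- exp_0; apply derivable_pt_lim_exp. }
destruct (derivable_pt_lim_0_estimate cos 0 e) as [d2 [Hd2 H2]]; auto.
{ replace 0 with (- sin 0) at 2 by (rewrite sin_0; ring); apply derivable_pt_lim_cos. }
destruct (derivable_pt_lim_0_estimate sin 1 e) as [d3 [Hd3 H3]]; auto.
{ rewrite <- cos_0; apply derivable_pt_lim_sin. }
exists (Rmin (Rmin d1 d2) (Rmin d3 (e / 2))); split; [repeat apply Rmin_pos; lra|].
intros [x y] Hh.
pose proof (Rmin_l (Rmin d1 d2) (Rmin d3 (e / 2))); pose proof (Rmin_r (Rmin d1 d2) (Rmin d3 (e / 2))).
pose proof (Rmin_l d1 d2); pose proof (Rmin_r d1 d2).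
pose proof (Rmin_l d3 (e / 2)); pose proof (Rmin_r d3 (e / 2)).
pose proof (Rmax_Cmod (x, y)) as Hm; cbn [fst snd] in Hm.
pose proof (Rmax_l (Rabs x) (Rabs y)); pose proof (Rmax_r (Rabs x) (Rabs y)).
specialize (H1 x ltac:(lra)); specialize (H2 y ltac:(lra)); specialize (H3 y ltac:(lra)).
rewrite exp_0 in H1; rewrite cos_0 in H2; rewrite sin_0 in H3.
set (m := Cmod (x, y)) in *.
(* Each component is arranged into first-order errors of [exp], [cos] and [sin] with bounded
   factors, plus the product [(exp x - 1) * y], small because [exp x - 1] is. *)
replace (cexp (x, y) - 1 - (x, y))%C with
  ((exp x * (cos y - 1 - 0 * y) + (exp x - 1 - 1 * x),
    exp x * (sin y - 0 - 1 * y) + ((exp x - 1 - 1 * x) + x) * y) : C)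
  by (apply injective_projections; cbn; ring).
pose proof (Rabs_pos x); pose proof (Rabs_pos y).
assert (Hex : Rabs (exp x - 1 - 1 * x + x) <= e).
{ apply Rle_trans with (1 := Rabs_triang _ _); nra. }
assert (Hex2 : Rabs (exp x) <= 2).
{ replace (exp x) with ((exp x - 1 - 1 * x + x) + 1) by ring.
  apply Rle_trans with (1 := Rabs_triang _ _); rewrite (Rabs_pos_eq 1); lra. }
pose proof (Rabs_pos (exp x)).
apply Rle_trans with (1 := Cmod_le_Rabs _ _).
apply Rle_trans with ((2 * (e * Rabs y) + e * Rabs x) + (2 * (e * Rabs y) + e * Rabs y)); [|nra].
apply Rplus_le_compat; apply Rle_trans with (1 := Rabs_triang _ _);
  apply Rplus_le_compat; rewrite ?Rabs_mult; try assumption;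
  apply Rmult_le_compat; auto using Rabs_pos; lra.
Qed.

Lemma is_derive_cexp w : is_derive (K := C_AbsRing) (V := AbsRing_NormedModule C_AbsRing) cexp w (cexp w).
Proof.
apply (is_derive_C_iff (AbsRing_NormedModule C_AbsRing)); intros eps Heps.
assert (HE : 0 < Cmod (cexp w)) by (rewrite Cmod_cexp; apply exp_pos).
destruct (cexp_estimate (eps / Cmod (cexp w))) as [d [Hd H]];
  [apply Rdiv_lt_0_compat; assumption|].
exists d; split; [exact Hd|]; intros v Hv.
change (Cmod (cexp v - cexp w - (v - w) * cexp w) <= eps * Cmod (v - w)).
replace (cexp v) with (cexp w * cexp (v - w))%C
  by (rewrite <- cexp_plus; f_equal; ring).
replace (cexp w * cexp (v - w) - cexp w - (v - w) * cexp w)%C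
  with (cexp w * (cexp (v - w) - 1 - (v - w)))%C by ring.
rewrite Cmod_mult.
apply Rle_trans with (1 := Rmult_le_compat_l _ _ _ (Rlt_le _ _ HE) (H _ Hv)).
apply Req_le; field; lra.
Qed.

(** * Derivatives of reciprocals, products, powers and composites *)

Lemma is_derive_Cinv (z : C) : z <> 0 ->
  is_derive (K := C_AbsRing) (V := AbsRing_NormedModule C_AbsRing) Cinv z (- (/ z * / z))%C.
Proof.
intros Hz; apply (is_derive_C_iff (AbsRing_NormedModule C_AbsRing)); intros eps Heps.
assert (Hm : 0 < Cmod z) by (apply Cmod_gt_0, Hz).
assert (Hm3 : 0 < Cmod z ^ 3 / 2) by (apply Rdiv_lt_0_compat; [apply pow_lt, Hm|lra]).
(* The error is exactly [(w - z)^2 / (w z^2)]. Within [Cmod z / 2] of [z] one has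
   [Cmod w >= Cmod z / 2], so it is at most [2 |w - z|^2 / |z|^3]. *)
exists (Rmin (Cmod z / 2) (eps * (Cmod z ^ 3 / 2))); split.
{ apply Rmin_pos; [lra|apply Rmult_lt_0_compat; assumption]. }
intros w Hw.
pose proof (Rlt_le_trans _ _ _ Hw (Rmin_l _ _)) as H1.
pose proof (Rlt_le_trans _ _ _ Hw (Rmin_r _ _)) as H2; clear Hw.
assert (Hzw : Cmod z <= Cmod w + Cmod (w - z)).
{ replace z with (w + - (w - z))%C at 1 by ring.
  apply Rle_trans with (1 := Cmod_triangle _ _); rewrite Cmod_opp; lra. }
assert (Hw0 : w <> 0) by (apply Cmod_gt_0; lra).
change (Cmod (/ w - / z - (w - z) * (- (/ z * / z))) <= eps * Cmod (w - z)).
replace (/ w - / z - (w - z) * (- (/ z * / z)))%C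
  with ((w - z) * ((w - z) * (/ w * (/ z * / z))))%C by (field; auto).
rewrite !Cmod_mult, !Cmod_inv by assumption.
rewrite (Rmult_comm eps); apply Rmult_le_compat_l; [apply Cmod_ge_0|].
apply Rle_trans with (Cmod (w - z) * (/ (Cmod z / 2) * (/ Cmod z * / Cmod z))).
- apply Rmult_le_compat_l; [apply Cmod_ge_0|].
  apply Rmult_le_compat_r; [apply Rlt_le, Rmult_lt_0_compat; apply Rinv_0_lt_compat, Hm|].
  apply Rinv_le_contravar; lra.
- apply Rle_trans with (eps * (Cmod z ^ 3 / 2) * (/ (Cmod z / 2) * (/ Cmod z * / Cmod z))).
  + apply Rmult_le_compat_r; [|lra].
    apply Rlt_le; repeat apply Rmult_lt_0_compat; apply Rinv_0_lt_compat; lra.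
  + apply Req_le; field; lra.
Qed.

Lemma ex_derive_scal_C (V : NormedModule C_AbsRing) (k : C -> C) (F : C -> V) (w : C) :
  ex_derive (K := C_AbsRing) (V := AbsRing_NormedModule C_AbsRing) k w ->
  ex_derive (K := C_AbsRing) F w ->
  ex_derive (K := C_AbsRing) (fun w => scal (k w) (F w)) w.
Proof.
intros [dk Hk] [dF HF]; exists (plus (scal dk (F w)) (scal (k w) dF)).
apply (filterdiff_ext_lin (K := C_AbsRing) (U := AbsRing_NormedModule C_AbsRing) (V := V)) with
  (l1 := fun t : C => plus (scal (scal (V := AbsRing_NormedModule C_AbsRing) t dk) (F w))
           (scal (k w) (scal t dF))).
- apply (filterdiff_scal_fct (K := C_AbsRing) (U := AbsRing_NormedModule C_AbsRing) w k F);
    [exact Cmult_comm|exact Hk|exact HF].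
- intros t; rewrite scal_distr_l; f_equal.
  + symmetry; exact (scal_assoc t dk (F w)).
  + rewrite !scal_assoc; f_equal; exact (Cmult_comm _ _).
Qed.

Lemma ex_derive_pow_n_C (g : C -> C) (k : nat) (w : C) :
  ex_derive (K := C_AbsRing) (V := AbsRing_NormedModule C_AbsRing) g w ->
  ex_derive (K := C_AbsRing) (V := AbsRing_NormedModule C_AbsRing)
    (fun w => pow_n (K := C_Ring) (g w) k) w.
Proof.
intros Hg; induction k as [|k IH].
- exact (ex_derive_const (K := C_AbsRing) (V := AbsRing_NormedModule C_AbsRing) _ w).
- exact (ex_derive_scal_C (AbsRing_NormedModule C_AbsRing) g _ w Hg IH).
Qed.

Lemma ex_derive_cexp_opp w :
  ex_derive (K := C_AbsRing) (V := AbsRing_NormedModule C_AbsRing) (fun w => cexp (- w)%C) w.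
Proof.
eexists; apply (is_derive_comp (K := C_AbsRing) (V := AbsRing_NormedModule C_AbsRing) cexp
  (fun w : C => (- w)%C)).
- apply is_derive_cexp.
- apply (is_derive_opp (K := C_AbsRing) (V := AbsRing_NormedModule C_AbsRing) (fun w : C => w)).
  apply is_derive_id.
Qed.

Lemma ex_derive_comp_cexp (V : NormedModule C_AbsRing) (F : C -> V) (w : C) :
  ex_derive (K := C_AbsRing) F (cexp w) -> ex_derive (K := C_AbsRing) (fun w => F (cexp w)) w.
Proof.
intros [l Hl]; eexists.
exact (is_derive_comp (K := C_AbsRing) F cexp w l _ Hl (is_derive_cexp w)).
Qed.

(** * Taylor expansion *)

Section Taylor.

Variable V : CompleteNormedModule C_AbsRing.

Add Ring sqz_ring : (sqz_ring_theory V).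

Notation Ccontinuous := (continuous (T := AbsRing_UniformSpace C_AbsRing)).
Notation holomorphic_at := (ex_derive (K := C_AbsRing)).

Lemma pow_n_mult_C (a b : C) (k : nat) :
  pow_n (K := C_Ring) (a * b)%C k
  = (pow_n (K := C_Ring) a k * pow_n (K := C_Ring) b k)%C.
Proof.
induction k as [|k IH]; [symmetry; exact (Cmult_1_l 1)|].
cbn [pow_n]; rewrite IH.
change (@mult C_Ring) with Cmult; match goal with |- @eq _ ?x ?y => change (@eq C x y) end; ring.
Qed.

Lemma zero_of_small_norm (v : V) : (forall eps, 0 < eps -> norm v <= eps) -> v = zero.
Proof.
intros H; apply (norm_eq_zero (V := V)), Rle_antisym; [|apply norm_ge_0].
apply le_epsilon; intros eps Heps; rewrite Rplus_0_l; auto.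
Qed.

Lemma scal_eq_zero (c : C) (v : V) : c <> 0 -> scal c v = zero -> v = zero.
Proof.
intros Hc H; transitivity (scal (/ c)%C (scal c v)).
- rewrite scal_assoc; transitivity (scal (@one C_Ring) v); [symmetry; exact (scal_one v)|].
  f_equal; symmetry; exact (Cinv_l c Hc).
- rewrite H; exact (scal_zero_r (V := V) _).
Qed.

(** * Integrals of periodic functions over vertical segments *)

Definition vertical_int (G : C -> V) (s : R) : V := CInt V (fun t => G (s, t)) 0 (2 * PI).

Lemma PI2_pos : 0 < 2 * PI.
Proof. pose proof PI_RGT_0; lra. Qed.

Lemma vertical_int_norm (G : C -> V) s M : (forall w, Ccontinuous G w) ->
  (forall t, 0 <= t <= 2 * PI -> norm (G (s, t)) <= M) ->
  norm (vertical_int G s) <= 2 * PI * M.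
Proof.
intros HG HM; replace (2 * PI * M) with ((2 * PI - 0) * M) by ring.
apply CInt_norm; [intros; apply continuous_ver, HG| |exact HM].
pose proof PI2_pos; lra.
Qed.

(** Differentiability is asked only on the closed strip between the two segments, so the lemma
    applies on either side of a singular line. *)
Lemma vertical_int_eq (G : C -> V) s1 s2 : s1 <= s2 ->
  (forall w, Ccontinuous G w) -> (forall x, G (x, 2 * PI) = G (x, 0)) ->
  (forall x y, s1 <= x <= s2 -> holomorphic_at G (x, y)) ->
  vertical_int G s1 = vertical_int G s2.
Proof.
intros [Hs| ->] HG Hper HD; [|reflexivity].
assert (H : boundary_int V G s1 s2 0 (2 * PI) = zero).
{ apply goursat; auto; apply PI2_pos. }
unfold boundary_int in H.
rewrite (CInt_ext V (fun t => G (t, 2 * PI)) (fun t => G (t, 0))) in H by (intros; apply Hper).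
fold (vertical_int G s1) (vertical_int G s2) in H.
assert (H' : scal Ci (minus (vertical_int G s2) (vertical_int G s1)) = zero).
{ refine (eq_trans _ H); module_ring V. }
apply scal_eq_zero in H'; [|intros H0; apply (f_equal Im) in H0; cbn in H0; lra].
transitivity (plus (vertical_int G s1) (minus (vertical_int G s2) (vertical_int G s1))).
- rewrite H'; module_ring V.
- module_ring V.
Qed.

(** A tube argument: around each [(s0, t)] the function varies by less than [eps / 2], and
    compactness of [[0, 2 * PI]] gives one width [d] for all [t]. Mere continuity of [G] suffices,
    which is what a singular line requires. *)
Lemma vertical_int_continuous (G : C -> V) s0 eps : (forall w, Ccontinuous G w) -> 0 < eps ->
  exists delta, 0 < delta /\ forall s, Rabs (s - s0) < delta ->
    norm (minus (vertical_int G s) (vertical_int G s0)) <= 2 * PI * eps.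
Proof.
intros HG Heps.
assert (Hloc : forall t : R, exists d : posreal, forall s t', Rabs (s - s0) < d ->
  Rabs (t' - t) < d -> norm (minus (G (s, t')) (G (s0, t))) < eps / 2).
{ intros t; destruct (proj1 (continuous_C_iff V G (s0, t)) (HG _) (eps / 2)) as [d [Hd H]]; [lra|].
  assert (Hd2 : 0 < d / 2) by lra.
  exists (mkposreal _ Hd2); cbn; intros s t' H1 H2; apply H.
  replace ((s, t') - (s0, t))%C with ((s - s0, t' - t) : C)
    by (apply injective_projections; cbn; ring).
  apply Rle_lt_trans with (1 := Cmod_le_Rabs _ _); lra. }
pose (delta := fun t => proj1_sig (constructive_indefinite_description _ (Hloc t))).
assert (Hdelta : forall t s t', Rabs (s - s0) < delta t -> Rabs (t' - t) < delta t ->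
  norm (minus (G (s, t')) (G (s0, t))) < eps / 2)
  by (intros t; exact (proj2_sig (constructive_indefinite_description _ (Hloc t)))).
destruct (compactness_value_1d 0 (2 * PI) delta) as [d Hd].
exists d; split; [apply cond_pos|]; intros s Hs.
unfold vertical_int; rewrite <- CInt_minus by (intros; apply continuous_ver, HG).
replace (2 * PI * eps) with ((2 * PI - 0) * eps) by ring.
apply CInt_norm; [|pose proof PI2_pos; lra|].
- intros t; apply (continuous_minus (V := V)); apply continuous_ver, HG.
(* Compactness supplies the tag [t] only under a double negation, which is harmless for the
   inequality to be proved. *)
- intros x Hx; apply NNPP; intros Hn; apply (Hd x Hx); intros [t [_ [Ht Htd]]]; apply Hn.
  replace (minus (G (s, x)) (G (s0, x))) with
    (minus (minus (G (s, x)) (G (s0, t))) (minus (G (s0, x)) (G (s0, t)))) by module_ring V.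
  apply Rle_trans with (1 := norm_minus_le V _ _).
  replace eps with (eps / 2 + eps / 2) by field.
  apply Rplus_le_compat; apply Rlt_le, Hdelta; try lra.
  rewrite Rminus_diag, Rabs_R0; apply cond_pos.
Qed.

(* The line [Re w = sigma] may carry removable singularities: the integral is
   constant on either side of it and continuous across it. *)
Lemma vertical_int_decay (G : C -> V) sigma M s0 :
  (forall w, Ccontinuous G w) -> (forall x, G (x, 2 * PI) = G (x, 0)) ->
  (forall x y, x <> sigma -> holomorphic_at G (x, y)) ->
  (forall x y, x <= s0 -> norm (G (x, y)) <= M * exp x) ->
  forall s, vertical_int G s = zero.
Proof.
intros HG Hper HD HM.
assert (Hlt : forall s, s < sigma -> vertical_int G s = zero).
{ intros s Hs; apply zero_of_small_norm; intros eps Heps.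
  pose proof PI2_pos.
  assert (HM0 : 0 < Rabs M + 1) by (pose proof (Rabs_pos M); lra).
  (* Far enough to the left, the decay bound on a segment of length [2 * PI] falls below [eps];
     [Rabs M + 1] is a bound that can be divided by. *)
  set (s' := Rmin (Rmin s s0) (ln (eps / (2 * PI * (Rabs M + 1))))).
  assert (Hq : 0 < eps / (2 * PI * (Rabs M + 1)))
    by (apply Rdiv_lt_0_compat; [exact Heps|apply Rmult_lt_0_compat; assumption]).
  assert (H1 : s' <= s) by (unfold s'; apply Rle_trans with (1 := Rmin_l _ _), Rmin_l).
  assert (H2 : s' <= s0) by (unfold s'; apply Rle_trans with (1 := Rmin_l _ _), Rmin_r).
  assert (H3 : exp s' <= eps / (2 * PI * (Rabs M + 1))).
  { rewrite <- (exp_ln (eps / (2 * PI * (Rabs M + 1)))) by exact Hq.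
    unfold s'; destruct (Rmin_r (Rmin s s0) (ln (eps / (2 * PI * (Rabs M + 1))))) as [Hl| ->];
      [apply Rlt_le, exp_increasing, Hl|apply Rle_refl]. }
  rewrite <- (vertical_int_eq G s' s); auto; [|intros x y Hx; apply HD; lra].
  apply Rle_trans with (2 * PI * ((Rabs M + 1) * exp s')).
  - apply vertical_int_norm; [exact HG|]; intros t _.
    apply Rle_trans with (1 := HM s' t H2).
    apply Rmult_le_compat_r; [apply Rlt_le, exp_pos|pose proof (Rle_abs M); lra].
  - rewrite <- Rmult_assoc.
    apply Rle_trans with (2 * PI * (Rabs M + 1) * (eps / (2 * PI * (Rabs M + 1)))).
    + apply Rmult_le_compat_l; [|exact H3]; apply Rlt_le, Rmult_lt_0_compat; assumption.
    + apply Req_le; field; split; lra. }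
assert (Hsigma : vertical_int G sigma = zero).
{ apply zero_of_small_norm; intros eps Heps; pose proof PI2_pos as Hpi.
  destruct (vertical_int_continuous G sigma (eps / (2 * PI))) as [d [Hd H]]; auto.
  { apply Rdiv_lt_0_compat; lra. }
  replace (2 * PI * (eps / (2 * PI))) with eps in H by (field; lra).
  replace (vertical_int G sigma)
    with (opp (minus (vertical_int G (sigma - d / 2)) (vertical_int G sigma)))
    by (rewrite Hlt by lra; module_ring V).
  rewrite (norm_opp (V := V)); apply H.
  replace (sigma - d / 2 - sigma) with (- (d / 2)) by ring.
  rewrite Rabs_Ropp, Rabs_pos_eq; lra. }
intros s; destruct (Rtotal_order s sigma) as [Hs|[->|Hs]]; auto.
apply zero_of_small_norm; intros eps Heps; pose proof PI2_pos as Hpi.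
destruct (vertical_int_continuous G sigma (eps / (2 * PI))) as [d [Hd H]]; auto.
{ apply Rdiv_lt_0_compat; lra. }
set (s' := Rmin s (sigma + d / 2)).
assert (H1 : s' <= s) by apply Rmin_l.
assert (H2 : s' <= sigma + d / 2) by apply Rmin_r.
assert (H3 : sigma < s') by (apply Rmin_glb_lt; lra).
rewrite <- (vertical_int_eq G s' s); auto; [|intros x y Hx; apply HD; lra].
replace (2 * PI * (eps / (2 * PI))) with eps in H by (field; lra).
replace (vertical_int G s') with (minus (vertical_int G s') (vertical_int G sigma))
  by (rewrite Hsigma; module_ring V).
apply H, Rabs_def1; lra.
Qed.

Lemma bounded_on_segment (F : R -> V) a b : a <= b -> (forall t, continuous F t) ->
  exists M, 0 <= M /\ forall t, a <= t <= b -> norm (F t) <= M.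
Proof.
intros Hab HF.
destruct (continuity_ab_maj (fun t => norm (F t)) a b Hab) as [m [Hm _]].
- intros t _; apply continuity_pt_filterlim.
  exact (filterlim_comp _ _ _ F norm _ _ _ (HF t) (filterlim_norm (V := V) (F t))).
- exists (norm (F m)); split; [apply norm_ge_0|exact Hm].
Qed.

Lemma holomorphic_continuous (F : C -> V) w : holomorphic_at F w -> Ccontinuous F w.
Proof. exact (ex_derive_continuous (K := C_AbsRing) (V := V) F w). Qed.

(** No primitive is computed: the integral does not depend on [s], yet moving from [s] to [s + 1]
    multiplies it by [exp (- 1) ^ k], which is less than 1 for [k > 0]. *)
Lemma vertical_int_pow_exp (k : nat) (v : V) s :
  (0 < k)%nat -> vertical_int (fun w => scal (pow_n (K := C_Ring) (cexp (- w)) k) v) s = zero.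
Proof.
intros Hk; set (G := fun w : C => scal (pow_n (K := C_Ring) (cexp (- w)) k) v).
assert (HD : forall w, holomorphic_at G w).
{ intros w; apply (ex_derive_scal_C V); [apply ex_derive_pow_n_C, ex_derive_cexp_opp|].
  exact (ex_derive_const (K := C_AbsRing) (V := V) v w). }
assert (HG : forall w, Ccontinuous G w) by (intros w; apply holomorphic_continuous, HD).
assert (Hper : forall x, G (x, 2 * PI) = G (x, 0))
  by (intros x; unfold G; rewrite cexp_opp_period; reflexivity).
assert (Hconst : vertical_int G s = vertical_int G (s + 1)) by (apply vertical_int_eq; auto; lra).
assert (Hscal : vertical_int G (s + 1) = scal (pow_n (K := C_Ring) (RtoC (exp (- 1))) k) (vertical_int G s)).
{ unfold vertical_int; rewrite <- CInt_scal by (intros; apply continuous_ver, HG).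
  apply CInt_ext; intros t; unfold G; rewrite scal_assoc; f_equal.
  replace (cexp (- ((s + 1)%R, t))) with (RtoC (exp (- 1)) * cexp (- (s, t)))%C; [apply pow_n_mult_C|].
  replace (- ((s + 1)%R, t))%C with (RtoC (- 1) + - (s, t))%C
      by (apply injective_projections; cbn; ring).
    rewrite cexp_plus; f_equal; unfold cexp; cbn; rewrite cos_0, sin_0.
    apply injective_projections; cbn; ring. }
assert (Hp : Cmod (pow_n (K := C_Ring) (RtoC (exp (- 1))) k) < 1).
{ apply Rle_lt_trans with (1 := abs_pow_n (K := C_AbsRing) (RtoC (exp (- 1))) k).
  change (Cmod (RtoC (exp (- 1))) ^ k < 1).
  assert (He : exp (- 1) < 1) by (rewrite <- exp_0; apply exp_increasing; lra).
  rewrite Cmod_R, Rabs_pos_eq by apply Rlt_le, exp_pos.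
  apply (pow_lt_1_compat (exp (- 1))); [|exact Hk]; pose proof (exp_pos (- 1)); lra. }
set (p := pow_n (K := C_Ring) (RtoC (exp (- 1))) k : C) in *.
apply (scal_eq_zero (1 - p)%C).
- intros H0; assert (H1 : p = 1) by (replace p with (1 - (1 - p))%C by ring; rewrite H0; ring).
  rewrite H1, Cmod_1 in Hp; lra.
- transitivity (minus (vertical_int G s) (vertical_int G (s + 1))).
  + rewrite Hscal; module_ring V.
  + rewrite <- Hconst; module_ring V.
Qed.

(** * Taylor coefficients and Cauchy's estimates *)

Variable f : C -> V.
Hypothesis Hf : forall z, holomorphic_at f z.

Definition cauchy_integrand (k : nat) (w : C) : V :=
  scal (pow_n (K := C_Ring) (cexp (- w)) k) (f (cexp w)).

(** Cauchy's formula, [1 / (2 pi i)] times the integral of [f z / z^(k+1) dz] over the unit circle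
    [s = 0]; [dz = i z dt] cancels the [i] and one power of [z]. *)
Definition taylor_coef (k : nat) : V :=
  scal (RtoC (/ (2 * PI))) (vertical_int (cauchy_integrand k) 0).

Lemma cauchy_integrand_holomorphic k w : holomorphic_at (cauchy_integrand k) w.
Proof.
apply (ex_derive_scal_C V); [apply ex_derive_pow_n_C, ex_derive_cexp_opp|].
apply (ex_derive_comp_cexp V), Hf.
Qed.

Lemma cauchy_integrand_continuous k w : Ccontinuous (cauchy_integrand k) w.
Proof. apply holomorphic_continuous, cauchy_integrand_holomorphic. Qed.

Lemma taylor_coef_radius k s :
  taylor_coef k = scal (RtoC (/ (2 * PI))) (vertical_int (cauchy_integrand k) s).
Proof.
assert (Hper : forall x, cauchy_integrand k (x, 2 * PI) = cauchy_integrand k (x, 0))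
  by (intros x; unfold cauchy_integrand; rewrite cexp_opp_period, cexp_period; reflexivity).
unfold taylor_coef; f_equal; destruct (Rle_dec 0 s) as [Hs|Hs].
- apply vertical_int_eq; auto using cauchy_integrand_continuous, cauchy_integrand_holomorphic.
- symmetry; apply vertical_int_eq;
    auto using cauchy_integrand_continuous, cauchy_integrand_holomorphic; lra.
Qed.

Lemma norm_pow_scal_le (z : C) (k : nat) (v : V) :
  norm (scal (pow_n (K := C_Ring) z k) v) <= Cmod z ^ k * norm v.
Proof.
apply Rle_trans with (1 := norm_scal (V := V) _ _).
apply Rmult_le_compat_r; [apply norm_ge_0|exact (abs_pow_n (K := C_AbsRing) z k)].
Qed.

(** [M] bounds [f] on the circle of radius [exp s] and is the same for all [k], so a circle larger
    than a given radius yields a geometric majorant. *)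
Lemma taylor_coef_bound s : exists M, 0 <= M /\
  forall k, norm (taylor_coef k) <= M * exp (- s) ^ k.
Proof.
pose proof PI2_pos.
destruct (bounded_on_segment (fun t => f (cexp (s, t))) 0 (2 * PI)) as [M [HM0 HM]]; [lra| |].
{ intros t; apply (continuous_ver V (fun w => f (cexp w))); intros w.
  apply holomorphic_continuous, (ex_derive_comp_cexp V), Hf. }
exists M; split; [exact HM0|]; intros k; rewrite (taylor_coef_radius k s).
apply Rle_trans with (1 := norm_scal (V := V) _ _).
change (Cmod (RtoC (/ (2 * PI))) * norm (vertical_int (cauchy_integrand k) s) <= M * exp (- s) ^ k).
rewrite Cmod_R, Rabs_pos_eq by (apply Rlt_le, Rinv_0_lt_compat; lra).
apply Rle_trans with (/ (2 * PI) * (2 * PI * (exp (- s) ^ k * M))).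
- apply Rmult_le_compat_l; [apply Rlt_le, Rinv_0_lt_compat; lra|].
  apply vertical_int_norm; [apply cauchy_integrand_continuous|]; intros t Ht.
  apply Rle_trans with (1 := norm_pow_scal_le _ _ _).
  rewrite Cmod_cexp; apply Rmult_le_compat_l; [apply pow_le, Rlt_le, exp_pos|apply HM, Ht].
- apply Req_le; field; lra.
Qed.

(** * The difference quotient and the remainder of the expansion *)

Variable z0 : C.

Definition difference_quotient (l : V) (z : C) : V :=
  if Ceq_dec z z0 then l else scal (/ (z - z0))%C (minus (f z) (f z0)).

Lemma difference_quotient_spec l z :
  f z = plus (f z0) (scal (z - z0)%C (difference_quotient l z)).
Proof.
unfold difference_quotient; destruct (Ceq_dec z z0) as [->|Hz].
- replace (z0 - z0)%C with (RtoC 0) by ring; module_ring V.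
- rewrite scal_assoc.
  replace (scal (mult (z - z0)%C (/ (z - z0))%C : C_Ring) (minus (f z) (f z0)))
    with (scal (RtoC 1) (minus (f z) (f z0))); [module_ring V|].
  f_equal; symmetry; apply (Cinv_r (z - z0)); intros H; apply Hz.
  replace z with (z - z0 + z0)%C by ring; rewrite H; ring.
Qed.

Lemma difference_quotient_holomorphic l z : z <> z0 ->
  holomorphic_at (difference_quotient l) z.
Proof.
intros Hz.
assert (Hzz : (z - z0)%C <> 0).
{ intros H; apply Hz; replace z with (z - z0 + z0)%C by ring; rewrite H; ring. }
apply (ex_derive_ext_loc (K := C_AbsRing) (V := V)
  (fun w : C => scal (/ (w - z0))%C (minus (f w) (f z0)))).
- exists (mkposreal _ (proj1 (Cmod_gt_0 _) Hzz)); intros w Hw.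
  unfold difference_quotient; destruct (Ceq_dec w z0) as [->|_]; [exfalso|reflexivity].
  change (Cmod (z0 - z) < Cmod (z - z0)) in Hw.
  replace (z0 - z)%C with (- (z - z0))%C in Hw by ring; rewrite Cmod_opp in Hw; lra.
- apply (ex_derive_scal_C V).
  + eexists; apply (is_derive_comp (K := C_AbsRing) (V := AbsRing_NormedModule C_AbsRing) Cinv
      (fun w : C => (w - z0)%C)); [apply is_derive_Cinv, Hzz|].
    apply (is_derive_minus (K := C_AbsRing) (V := AbsRing_NormedModule C_AbsRing)
      (fun w : C => w) (fun _ => z0));
      [apply is_derive_id|exact (is_derive_const (K := C_AbsRing) (V := AbsRing_NormedModule C_AbsRing) z0 z)].
  + apply (ex_derive_minus (K := C_AbsRing) (V := V) f (fun _ => f z0)); [apply Hf|].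
    exact (ex_derive_const (K := C_AbsRing) (V := V) (f z0) z).
Qed.

Lemma difference_quotient_continuous l z : is_derive (K := C_AbsRing) f z0 l ->
  Ccontinuous (difference_quotient l) z.
Proof.
intros Hl; destruct (Ceq_dec z z0) as [->|Hz];
  [|apply holomorphic_continuous, difference_quotient_holomorphic, Hz].
apply (continuous_C_iff V); intros eps Heps.
destruct (proj1 (is_derive_C_iff V f z0 l) Hl (eps / 2)) as [d [Hd H]]; [lra|].
exists d; split; [exact Hd|]; intros w Hw.
unfold difference_quotient at 2; destruct (Ceq_dec z0 z0) as [_|Hn]; [|contradiction].
unfold difference_quotient; destruct (Ceq_dec w z0) as [->|Hwz].
- replace (minus l l) with (zero : V) by module_ring V; 
  apply Rle_lt_trans with (2 := Heps), Req_le, (norm_zero (V := V)).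
- assert (Hc : (w - z0)%C <> 0).
  { intros H0; apply Hwz; replace w with (w - z0 + z0)%C by ring; rewrite H0; ring. }
  assert (Hl' : l = scal (/ (w - z0))%C (scal (w - z0)%C l)).
  { rewrite scal_assoc; symmetry; transitivity (scal (@one C_Ring) l); [|exact (scal_one l)].
    f_equal; exact (Cinv_l _ Hc). }
  rewrite Hl' at 1.
  replace (minus _ _) with
    (scal (/ (w - z0))%C (minus (minus (f w) (f z0)) (scal (w - z0)%C l))) by module_ring V.
  apply Rle_lt_trans with (1 := norm_scal (V := V) _ _).
  change (abs (/ (w - z0))%C) with (Cmod (/ (w - z0))).
  rewrite Cmod_inv by exact Hc; pose proof (proj1 (Cmod_gt_0 _) Hc).
  apply Rle_lt_trans with (/ Cmod (w - z0) * (eps / 2 * Cmod (w - z0))).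
  + apply Rmult_le_compat_l; [apply Rlt_le, Rinv_0_lt_compat, H0|apply H, Hw].
  + replace (/ Cmod (w - z0) * (eps / 2 * Cmod (w - z0))) with (eps / 2) by (field; lra); lra.
Qed.


Variable l : V.
Hypothesis Hl : is_derive (K := C_AbsRing) f z0 l.

(** With [z = cexp w] and [h] the difference quotient, this is [(z0 / z)^n z h(z)]. Index 0 gives
    the integrand whose integral vanishes; large [n] is small on circles around 0 of radius above
    [Cmod z0]. *)
Definition remainder_integrand (n : nat) (w : C) : V :=
  scal (pow_n (K := C_Ring) (z0 * cexp (- w))%C n)
    (scal (cexp w) (difference_quotient l (cexp w))).

Lemma holomorphic_continuous_C (g : C -> C) w :
  ex_derive (K := C_AbsRing) (V := AbsRing_NormedModule C_AbsRing) g w ->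
  continuous (T := AbsRing_UniformSpace C_AbsRing) (U := AbsRing_UniformSpace C_AbsRing) g w.
Proof. exact (ex_derive_continuous (K := C_AbsRing) (V := AbsRing_NormedModule C_AbsRing) g w). Qed.

Lemma ratio_pow_holomorphic n w :
  ex_derive (K := C_AbsRing) (V := AbsRing_NormedModule C_AbsRing)
    (fun w => pow_n (K := C_Ring) (z0 * cexp (- w))%C n) w.
Proof.
apply ex_derive_pow_n_C.
apply (ex_derive_scal_C (AbsRing_NormedModule C_AbsRing) (fun _ => z0) (fun w => cexp (- w)));
  [|apply ex_derive_cexp_opp].
exact (ex_derive_const (K := C_AbsRing) (V := AbsRing_NormedModule C_AbsRing) z0 w).
Qed.

Lemma cexp_holomorphic w :
  ex_derive (K := C_AbsRing) (V := AbsRing_NormedModule C_AbsRing) cexp w.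
Proof. exists (cexp w); apply is_derive_cexp. Qed.

Lemma remainder_integrand_continuous n w : Ccontinuous (remainder_integrand n) w.
Proof.
apply Ccontinuous_scal; [apply holomorphic_continuous_C, ratio_pow_holomorphic|].
apply Ccontinuous_scal; [apply holomorphic_continuous_C, cexp_holomorphic|].
apply (continuous_comp (U := AbsRing_UniformSpace C_AbsRing) (V := AbsRing_UniformSpace C_AbsRing)
  cexp (difference_quotient l)); [apply holomorphic_continuous_C, cexp_holomorphic|].
apply difference_quotient_continuous, Hl.
Qed.

Lemma vertical_int_remainder_0 s : vertical_int (remainder_integrand 0) s = zero.
Proof.
destruct (proj1 (continuous_C_iff V (difference_quotient l) (RtoC 0))
  (difference_quotient_continuous l (RtoC 0) Hl) 1 Rlt_0_1) as [d [Hd H]].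
(* [cexp] can reach [z0] only on the line [Re w = ln (Cmod z0)]; for [z0 = 0] it never does, and any
   [sigma] would do. Left of [ln (d / 2)], [cexp w] is so close to 0 that the quotient differs from
   its value at 0 by less than 1. *)
apply vertical_int_decay with (sigma := ln (Cmod z0)) (s0 := ln (d / 2))
  (M := norm (difference_quotient l 0) + 1).
- apply remainder_integrand_continuous.
- intros x; unfold remainder_integrand; rewrite cexp_opp_period, cexp_period; reflexivity.
- intros x y Hx; apply (ex_derive_scal_C V); [apply ratio_pow_holomorphic|].
  apply (ex_derive_scal_C V); [apply cexp_holomorphic|].
  apply (ex_derive_comp_cexp V), difference_quotient_holomorphic; intros He; apply Hx.
  rewrite <- He, Cmod_cexp, ln_exp; reflexivity.
- intros x y Hx.
  assert (Hex : exp x < d).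
  { apply Rle_lt_trans with (d / 2); [|lra].
    rewrite <- (exp_ln (d / 2)) by lra.
    destruct Hx as [Hx| ->]; [apply Rlt_le, exp_increasing, Hx|apply Rle_refl]. }
  apply Rle_trans with (1 := norm_pow_scal_le _ _ _); cbn [pow]; rewrite Rmult_1_l.
  apply Rle_trans with (1 := norm_scal (V := V) _ _).
  change (abs (cexp (x, y))) with (Cmod (cexp (x, y))); rewrite Cmod_cexp; cbn [Re fst].
  rewrite Rmult_comm; apply Rmult_le_compat_r; [apply Rlt_le, exp_pos|].
  specialize (H (cexp (x, y))).
  replace (difference_quotient l (cexp (x, y))) with
    (plus (difference_quotient l 0)
       (minus (difference_quotient l (cexp (x, y))) (difference_quotient l 0))) by module_ring V.
  apply Rle_trans with (1 := norm_triangle (V := V) _ _).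
  apply Rplus_le_compat_l, Rlt_le, H.
  replace (cexp (x, y) - 0)%C with (cexp (x, y)) by ring; rewrite Cmod_cexp; exact Hex.
Qed.

(** In [f z = f z0 + (z - z0) h z], multiplied by [(z0 / z)^k], the term with [z] is the remainder
    of index [k], and the term with [z0 = z (z0 / z)] that of index [k + 1]. *)
Lemma cauchy_integrand_remainder k w :
  scal (pow_n (K := C_Ring) z0 k) (cauchy_integrand k w)
  = plus (scal (pow_n (K := C_Ring) z0 k) (scal (pow_n (K := C_Ring) (cexp (- w)) k) (f z0)))
      (minus (remainder_integrand k w) (remainder_integrand (S k) w)).
Proof.
unfold cauchy_integrand; rewrite (difference_quotient_spec l (cexp w)) at 1.
unfold remainder_integrand; generalize (difference_quotient l (cexp w)); intros h.
cbn [pow_n]; rewrite pow_n_mult_C.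
set (p := pow_n (K := C_Ring) z0 k : C); set (q := pow_n (K := C_Ring) (cexp (- w)) k : C).
change (@mult C_Ring) with Cmult.
assert (E : forall u : V, scal (z0 * cexp (- w) * (p * q))%C (scal (cexp w) u)
  = scal (z0 * (p * q))%C u).
{ intros u; rewrite scal_assoc; f_equal; change (@mult C_Ring) with Cmult.
  transitivity (z0 * (p * q) * (cexp (- w) * cexp w))%C.
  - match goal with |- @eq _ ?x ?y => change (@eq C x y) end; ring.
  - rewrite cexp_opp_l; apply Cmult_1_r. }
rewrite E; module_ring V.
Qed.

(** Integrating the previous identity, the constant [f z0] survives only for [k = 0], by
    [vertical_int_pow_exp]. *)
Lemma taylor_term_remainder k s :
  scal (pow_n (K := C_Ring) z0 k) (taylor_coef k)
  = plus (match k with O => f z0 | S _ => zero end)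
      (scal (RtoC (/ (2 * PI))) (minus (vertical_int (remainder_integrand k) s)
         (vertical_int (remainder_integrand (S k)) s))).
Proof.
pose proof PI2_pos as Hpi.
pose (g := fun w => scal (pow_n (K := C_Ring) (cexp (- w)) k) (f z0)).
assert (Hg : forall w, Ccontinuous g w).
{ intros w; apply Ccontinuous_scal; [|apply Ccontinuous_const].
  apply holomorphic_continuous_C, ex_derive_pow_n_C, ex_derive_cexp_opp. }
assert (Hgs : forall t : R, continuous (fun t => g (s, t)) t)
  by (intros; apply continuous_ver, Hg).
assert (Hr : forall n (t : R), continuous (fun t => remainder_integrand n (s, t)) t)
  by (intros; apply continuous_ver, remainder_integrand_continuous).
assert (H : scal (pow_n (K := C_Ring) z0 k) (vertical_int (cauchy_integrand k) s)
  = plus (scal (pow_n (K := C_Ring) z0 k) (vertical_int g s))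
      (minus (vertical_int (remainder_integrand k) s)
         (vertical_int (remainder_integrand (S k)) s))).
{ unfold vertical_int.
  rewrite <- CInt_minus, <- !CInt_scal; auto.
  - refine (eq_trans _ (CInt_plus V _ _ _ _ _ _)).
    + apply CInt_ext; intros t; apply cauchy_integrand_remainder.
    + intros t; apply (continuous_scal_r (V := V)), Hgs.
    + intros t; apply (continuous_minus (V := V)); apply Hr.
  - intros t; apply continuous_ver, cauchy_integrand_continuous. }
rewrite (taylor_coef_radius k s).
transitivity (scal (RtoC (/ (2 * PI)))
  (scal (pow_n (K := C_Ring) z0 k) (vertical_int (cauchy_integrand k) s))); [module_ring V|].
rewrite H; destruct k as [|k].
- assert (E : vertical_int g s = scal (RtoC (2 * PI)) (f z0)).
  { unfold vertical_int, g; cbn [pow_n].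
    transitivity (CInt V (fun _ => f z0) 0 (2 * PI)).
    - apply CInt_ext; intros t; exact (scal_one (f z0)).
    - rewrite CInt_const; do 2 f_equal; ring. }
  rewrite E; cbn [pow_n]; change (@one C_Ring) with (RtoC 1).
  transitivity (plus (scal (RtoC (/ (2 * PI)) * RtoC (2 * PI))%C (f z0))
    (scal (RtoC (/ (2 * PI))) (minus (vertical_int (remainder_integrand 0) s)
       (vertical_int (remainder_integrand 1) s)))); [module_ring V|].
  rewrite <- RtoC_mult, Rinv_l by lra; module_ring V.
- unfold g; rewrite vertical_int_pow_exp by lia; module_ring V.
Qed.

Lemma taylor_partial_sum n s :
  sum_n (fun k => scal (pow_n (K := C_Ring) z0 k) (taylor_coef k)) n
  = minus (f z0) (scal (RtoC (/ (2 * PI))) (vertical_int (remainder_integrand (S n)) s)).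
Proof.
induction n as [|n IH].
- rewrite sum_O, (taylor_term_remainder 0 s), vertical_int_remainder_0; module_ring V.
- rewrite sum_Sn, IH, (taylor_term_remainder (S n) s); module_ring V.
Qed.

Lemma remainder_bound : exists s M rho, 0 <= rho < 1 /\
  forall n, norm (vertical_int (remainder_integrand n) s) <= rho ^ n * M.
Proof.
pose proof PI2_pos as Hpi; pose proof (Cmod_ge_0 z0) as Hz.
(* On the circle of radius [Cmod z0 + 1] the ratio [z0 / z] has modulus
   [Cmod z0 / (Cmod z0 + 1) < 1], and a bound for index 0 serves every index after multiplication by
   its powers. *)
set (s := ln (Cmod z0 + 1)).
assert (Hs : exp (- s) = / (Cmod z0 + 1)) by (unfold s; rewrite exp_Ropp, exp_ln; lra).
assert (HE : forall t, continuous (fun t => remainder_integrand 0 (s, t)) t)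
  by (intros; apply continuous_ver, remainder_integrand_continuous).
destruct (bounded_on_segment _ 0 (2 * PI) (Rlt_le _ _ Hpi) HE) as [M [HM0 HM]].
exists s, (2 * PI * M), (Cmod z0 / (Cmod z0 + 1)).
assert (Hrho : 0 <= Cmod z0 / (Cmod z0 + 1)).
{ apply Rmult_le_pos; [exact Hz|apply Rlt_le, Rinv_0_lt_compat; lra]. }
split.
- split; [exact Hrho|]; apply Rmult_lt_reg_r with (Cmod z0 + 1); [lra|].
  unfold Rdiv; rewrite Rmult_assoc, Rinv_l by lra; lra.
- intros n; replace (_ ^ n * _) with (2 * PI * ((Cmod z0 / (Cmod z0 + 1)) ^ n * M)) by ring.
  apply vertical_int_norm; [apply remainder_integrand_continuous|]; intros t Ht.
  replace (remainder_integrand n (s, t)) with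
    (scal (pow_n (K := C_Ring) (z0 * cexp (- (s, t)))%C n) (remainder_integrand 0 (s, t))).
  + apply Rle_trans with (1 := norm_pow_scal_le _ _ _).
    rewrite Cmod_mult, Cmod_cexp; cbn [Re fst Copp]; rewrite Hs.
    apply Rmult_le_compat; auto using norm_ge_0, Rle_refl.
    apply pow_le, Hrho.
  + unfold remainder_integrand; cbn [pow_n]; f_equal; exact (scal_one _).
Qed.

Lemma taylor_pseries_at : is_pseries (K := C_AbsRing) taylor_coef z0 (f z0).
Proof.
pose proof PI2_pos as Hpi.
destruct remainder_bound as [s [M [rho [[Hr0 Hr1] HM]]]].
apply filterlim_locally; intros eps.
assert (Hd : 0 < eps * (2 * PI) / (Rabs M + 1)).
{ pose proof (Rabs_pos M); apply Rdiv_lt_0_compat; [|lra].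
  apply Rmult_lt_0_compat; [apply cond_pos|lra]. }
destruct (pow_lt_1_zero rho) with (y := eps * (2 * PI) / (Rabs M + 1)) as [N HN]; auto.
{ rewrite Rabs_pos_eq; assumption. }
exists N; intros n Hn; apply (norm_compat1 (V := V)).
apply Rle_lt_trans with
  (norm (scal (RtoC (- / (2 * PI))) (vertical_int (remainder_integrand (S n)) s))).
{ apply Req_le; f_equal.
  refine (eq_trans (f_equal (fun v : V => minus v (f z0)) (taylor_partial_sum n s)) _).
  module_ring V. }
apply Rle_lt_trans with (1 := norm_scal (V := V) _ _).
change (abs (RtoC (- / (2 * PI)))) with (Cmod (RtoC (- / (2 * PI)))).
rewrite Cmod_R, Rabs_Ropp, Rabs_pos_eq by (apply Rlt_le, Rinv_0_lt_compat; lra).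
specialize (HN (S n) ltac:(lia)).
rewrite Rabs_pos_eq in HN by apply pow_le, Hr0.
pose proof (Rabs_pos M); pose proof (Rle_abs M).
assert (Hp : rho ^ S n * M <= rho ^ S n * (Rabs M + 1)).
{ apply Rmult_le_compat_l; [apply pow_le, Hr0|lra]. }
apply (Rmult_lt_compat_r (Rabs M + 1)) in HN; [|lra].
replace (eps * (2 * PI) / (Rabs M + 1) * (Rabs M + 1)) with (2 * PI * eps) in HN by (field; lra).
apply (Rmult_lt_reg_l (2 * PI)); [lra|].
rewrite <- Rmult_assoc, Rinv_r, Rmult_1_l by lra.
specialize (HM (S n)); lra.
Qed.

End Taylor.

(** The point and the derivative at it were fixed only for the convergence proof; the coefficients
    involve neither, so one series serves every [z]. *)
Theorem entire_taylor (V : CompleteNormedModule C_AbsRing) (f : C -> V) :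
  (forall z, ex_derive (K := C_AbsRing) f z) ->
  forall z, is_pseries (K := C_AbsRing) (taylor_coef V f) z (f z).
Proof. intros Hf z; destruct (Hf z) as [l Hl]; exact (taylor_pseries_at V f Hf z l Hl). Qed.

(** * Everywhere convergent power series *)

Section EntirePowerSeries.

Variable V : CompleteNormedModule C_AbsRing.

Add Ring sqz_ring : (sqz_ring_theory V).

(** Absolute convergence at every radius. Real radii replace the [exp n] of [exp_decreasing], so
    that enlarging [r] to [2 * r], [3 * r] or [r + 1] is immediate. *)
Definition abs_summable (c : nat -> V) : Prop :=
  forall r, 0 <= r -> ex_series (V := R_NormedModule) (fun k => norm (c k) * r ^ k).

Lemma ex_series_R_le (x y : nat -> R) : (forall k, 0 <= x k <= y k) ->
  ex_series (V := R_NormedModule) y -> ex_series (V := R_NormedModule) x.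
Proof.
intros H; apply (ex_series_le (V := R_CompleteNormedModule)); intros k.
change (Rabs (x k) <= y k); rewrite Rabs_pos_eq; apply H.
Qed.

Lemma norm_series_le (x : nat -> V) (y : nat -> R) v s : (forall k, norm (x k) <= y k) ->
  is_series x v -> is_series (V := R_NormedModule) y s -> norm v <= s.
Proof.
intros Hxy Hx Hy.
assert (Hle : Rbar_le (norm v) s); [|exact Hle].
apply (filterlim_le (F := eventually) (fun n => norm (sum_n x n)) (sum_n y)).
- exists 0%nat; intros n _.
  apply Rle_trans with (sum_n (fun k => norm (x k)) n).
  + exact (norm_sum_n_m (V := V) x 0 n).
  + apply sum_n_m_le; exact Hxy.
- exact (filterlim_comp _ _ _ _ _ _ _ _ Hx (filterlim_norm (V := V) v)).
- exact Hy.
Qed.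

(** The weights are general in order to sum both the power series and its formal derivative. *)
Lemma abs_summable_weighted (c : nat -> V) (p : nat -> C) r : abs_summable c -> 0 <= r ->
  (forall k, Cmod (p k) <= r ^ k) -> ex_series (fun k => scal (p k) (c k)).
Proof.
intros Hc Hr Hp; apply (ex_series_le (V := V)) with (2 := Hc r Hr); intros k.
apply Rle_trans with (1 := norm_scal (V := V) _ _); rewrite Rmult_comm.
apply Rmult_le_compat_l; [apply norm_ge_0|apply Hp].
Qed.

Lemma abs_summable_pseries (c : nat -> V) z : abs_summable c ->
  exists v, is_pseries (K := C_AbsRing) c z v.
Proof.
intros Hc; apply (abs_summable_weighted c (pow_n (K := C_Ring) z) (Cmod z) Hc (Cmod_ge_0 z)).
exact (abs_pow_n (K := C_AbsRing) z).
Qed.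

Lemma pseries_unique (c : nat -> V) z u v :
  is_pseries (K := C_AbsRing) c z u -> is_pseries (K := C_AbsRing) c z v -> u = v.
Proof. apply (filterlim_locally_unique (V := V)). Qed.

(* [pow_derivative z0 k = k z0^(k-1)] *)
Fixpoint pow_derivative (z0 : C) (k : nat) : C :=
  match k with
  | O => 0
  | S k => (z0 * pow_derivative z0 k + pow_n (K := C_Ring) z0 k)%C
  end.

Lemma Cmod_pow_n_le (z : C) r k : Cmod z <= r -> Cmod (pow_n (K := C_Ring) z k) <= r ^ k.
Proof.
intros Hr; apply Rle_trans with (1 := abs_pow_n (K := C_AbsRing) z k).
apply pow_incr; split; [apply Cmod_ge_0|exact Hr].
Qed.

Lemma pow_derivative_bound z0 r k : Cmod z0 <= r -> 1 <= r ->
  Cmod (pow_derivative z0 k) <= (2 * r) ^ k.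
Proof.
intros Hz Hr; induction k as [|k IH]; cbn [pow_derivative].
- rewrite Cmod_0; cbn; lra.
- apply Rle_trans with (1 := Cmod_triangle _ _); rewrite Cmod_mult.
  apply Rle_trans with (r * (2 * r) ^ k + (2 * r) ^ k).
  + apply Rplus_le_compat.
    * apply Rmult_le_compat; auto using Cmod_ge_0.
    * apply Rle_trans with (1 := Cmod_pow_n_le z0 r k Hz); apply pow_incr; lra.
  + cbn [pow]; assert (0 <= (2 * r) ^ k) by (apply pow_le; lra); nra.
Qed.

(** The remainder for [k + 1] is [w] times the one for [k], plus [(w - z0)^2] times
    [pow_derivative z0 k]. The crude base [3 * r] costs nothing, as the coefficients are summable at
    every radius. *)
Lemma pow_taylor_bound z0 w r k : Cmod z0 <= r -> Cmod w <= r -> 1 <= r ->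
  Cmod (pow_n (K := C_Ring) w k - pow_n (K := C_Ring) z0 k - (w - z0) * pow_derivative z0 k)
  <= Cmod (w - z0) ^ 2 * (3 * r) ^ k.
Proof.
intros Hz Hw Hr; induction k as [|k IH].
- cbn [pow_n pow_derivative]; change (@one C_Ring) with (RtoC 1).
  replace (1 - 1 - (w - z0) * 0)%C with (RtoC 0) by ring.
  rewrite Cmod_0; cbn [pow]; pose proof (Cmod_ge_0 (w - z0)); nra.
- cbn [pow_n pow_derivative].
  set (p := pow_n (K := C_Ring) w k : C) in *; set (q := pow_n (K := C_Ring) z0 k : C) in *.
  set (d := pow_derivative z0 k) in *; change (@mult C_Ring) with Cmult.
  replace (w * p - z0 * q - (w - z0) * (z0 * d + q))%C
    with (w * (p - q - (w - z0) * d) + (w - z0) * (w - z0) * d)%C by ring.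
  apply Rle_trans with (1 := Cmod_triangle _ _); rewrite !Cmod_mult.
  apply Rle_trans with (r * (Cmod (w - z0) ^ 2 * (3 * r) ^ k) + Cmod (w - z0) ^ 2 * (3 * r) ^ k).
  + apply Rplus_le_compat.
    * apply Rmult_le_compat; auto using Cmod_ge_0.
    * replace (Cmod (w - z0) * Cmod (w - z0)) with (Cmod (w - z0) ^ 2) by ring.
      apply Rmult_le_compat_l; [apply pow2_ge_0|].
      apply Rle_trans with (1 := pow_derivative_bound z0 r k Hz Hr).
      apply pow_incr; lra.
  + cbn [pow]; assert (0 <= (3 * r) ^ k) by (apply pow_le; lra).
    pose proof (Cmod_ge_0 (w - z0)).
    set (t := Cmod (w - z0) * (Cmod (w - z0) * 1)); assert (0 <= t) by (unfold t; nra).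
    assert (0 <= t * (3 * r) ^ k) by (apply Rmult_le_pos; assumption); nra.
Qed.

(** The second-order remainders of the monomials are summed directly, giving an error
    [Cmod (w - z0) ^ 2 * s]; no theorem on uniform limits is involved. The radius [Cmod z0 + 1]
    covers every [w] within 1 of [z0]. *)
Lemma pseries_holomorphic (c : nat -> V) (f : C -> V) z0 : abs_summable c ->
  (forall z, is_pseries (K := C_AbsRing) c z (f z)) -> ex_derive (K := C_AbsRing) f z0.
Proof.
intros Hc Hf.
pose proof (Cmod_ge_0 z0) as Hz0.
set (r := Cmod z0 + 1); assert (Hr : 1 <= r) by (unfold r; lra).
destruct (abs_summable_weighted c (pow_derivative z0) (2 * r) Hc) as [l Hl]; [lra| |].
{ intros k; apply pow_derivative_bound; unfold r in *; lra. }
destruct (Hc (3 * r)) as [s Hs]; [lra|].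
exists l; apply (is_derive_C_iff V); intros eps Heps.
exists (Rmin 1 (eps / (Rabs s + 1))).
assert (Hs0 : 0 < Rabs s + 1) by (pose proof (Rabs_pos s); lra).
assert (Hq : 0 < eps / (Rabs s + 1)) by (apply Rdiv_lt_0_compat; assumption).
split; [apply Rmin_pos; lra|]; intros w Hw.
pose proof (Rlt_le_trans _ _ _ Hw (Rmin_l _ _)) as H1.
pose proof (Rlt_le_trans _ _ _ Hw (Rmin_r _ _)) as H2; clear Hw.
assert (Hwr : Cmod w <= r).
{ replace w with ((w - z0) + z0)%C by ring.
  apply Rle_trans with (1 := Cmod_triangle _ _); unfold r; lra. }
assert (Hle : norm (minus (minus (f w) (f z0)) (scal (w - z0)%C l)) <= Cmod (w - z0) ^ 2 * s).
{ apply norm_series_le with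
    (x := fun k => scal (pow_n (K := C_Ring) w k - pow_n (K := C_Ring) z0 k
                         - (w - z0) * pow_derivative z0 k)%C (c k))
    (y := fun k => Cmod (w - z0) ^ 2 * (norm (c k) * (3 * r) ^ k)).
  - intros k; apply Rle_trans with (1 := norm_scal (V := V) _ _).
    apply Rle_trans with (Cmod (w - z0) ^ 2 * (3 * r) ^ k * norm (c k)); [|right; ring].
    apply Rmult_le_compat_r; [apply norm_ge_0|].
    apply pow_taylor_bound; unfold r in *; lra.
  - pose proof (is_series_minus (V := V) _ _ _ _
      (is_series_minus (V := V) _ _ _ _ (Hf w) (Hf z0))
      (is_series_scal (V := V) ((w - z0)%C : C_AbsRing) _ _ Hl)) as H.
    apply (is_series_ext (V := V)) with (2 := H); intros k.
    set (p := pow_n (K := C_Ring) w k : C); set (q := pow_n (K := C_Ring) z0 k : C).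
    change (minus (minus (scal p (c k)) (scal q (c k)))
      (scal (w - z0)%C (scal (pow_derivative z0 k) (c k)))
      = scal (p - q - (w - z0) * pow_derivative z0 k)%C (c k)); module_ring V.
  - exact (is_series_scal (V := R_NormedModule) (Cmod (w - z0) ^ 2) _ _ Hs). }
apply Rle_trans with (1 := Hle).
pose proof (Rle_abs s); pose proof (Cmod_ge_0 (w - z0)) as H0.
apply Rle_trans with (Cmod (w - z0) * (Cmod (w - z0) * (Rabs s + 1))).
{ replace (Cmod (w - z0) ^ 2 * s) with (Cmod (w - z0) * (Cmod (w - z0) * s)) by ring.
  apply Rmult_le_compat_l; [exact H0|]; apply Rmult_le_compat_l; lra. }
rewrite (Rmult_comm eps); apply Rmult_le_compat_l; [exact H0|].
apply (Rmult_lt_compat_r (Rabs s + 1)) in H2; [|exact Hs0].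
replace (eps / (Rabs s + 1) * (Rabs s + 1)) with eps in H2 by (field; lra); lra.
Qed.

(** * Uniqueness of the coefficients *)

Lemma abs_summable_decr (c : nat -> V) : abs_summable c -> abs_summable (PS_decr_1 c).
Proof.
(* The shift is absorbed by [r ^ k <= (r + 1) ^ (k + 1)], which avoids dividing by a possibly zero
   [r]. *)
intros Hc r Hr; assert (Hr1 : 0 <= r + 1) by lra.
pose proof (proj1 (ex_series_incr_1 (V := R_NormedModule) _) (Hc (r + 1) Hr1)) as H.
apply ex_series_R_le with (2 := H); intros k; unfold PS_decr_1.
assert (0 <= r ^ k) by (apply pow_le, Hr).
assert (r ^ k <= (r + 1) ^ k) by (apply pow_incr; lra).
split; [apply Rmult_le_pos; [apply norm_ge_0|assumption]|].
apply Rmult_le_compat_l; [apply norm_ge_0|]; cbn [pow]; nra.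
Qed.

Lemma abs_summable_minus (c d : nat -> V) :
  abs_summable c -> abs_summable d -> abs_summable (fun k => minus (c k) (d k)).
Proof.
intros Hc Hd r Hr.
apply ex_series_R_le with (2 := ex_series_plus (V := R_NormedModule) _ _ (Hc r Hr) (Hd r Hr)).
intros k; assert (0 <= r ^ k) by (apply pow_le, Hr).
split; [apply Rmult_le_pos; [apply norm_ge_0|assumption]|].
change (norm (minus (c k) (d k)) * r ^ k <= norm (c k) * r ^ k + norm (d k) * r ^ k).
rewrite <- Rmult_plus_distr_r; apply Rmult_le_compat_r; [assumption|apply norm_minus_le].
Qed.

(** The sum is assumed to vanish only for [z <> 0] because dividing by [z] preserves exactly this in
    the induction on [k]. The coefficient of index 0 is recovered by continuity of the sum at 0. *)
Lemma pseries_zero_coef (k : nat) : forall c : nat -> V, abs_summable c ->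
  (forall z : C, z <> 0 -> is_pseries (K := C_AbsRing) c z zero) -> c k = zero.
Proof.
assert (H0 : forall c : nat -> V, abs_summable c ->
  (forall z : C, z <> 0 -> is_pseries (K := C_AbsRing) c z zero) -> c 0%nat = zero).
{ intros c Hc Hz.
  pose (f := fun z => proj1_sig (constructive_indefinite_description _ (abs_summable_pseries c z Hc))).
  assert (Hf : forall z, is_pseries (K := C_AbsRing) c z (f z))
    by (intros z; exact (proj2_sig (constructive_indefinite_description _ (abs_summable_pseries c z Hc)))).
  pose proof (holomorphic_continuous V f (RtoC 0) (pseries_holomorphic c f (RtoC 0) Hc Hf)) as Hcont.
  apply (zero_of_small_norm V); intros eps Heps.
  destruct (proj1 (continuous_C_iff V f (RtoC 0)) Hcont eps Heps) as [d [Hd H]].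
  specialize (H (RtoC (d / 2))).
  replace (f (RtoC 0)) with (c 0%nat) in H
    by exact (pseries_unique c _ _ _ (is_pseries_0 (K := C_AbsRing) (V := V) c) (Hf (RtoC 0))).
  assert (Hd2 : RtoC (d / 2) <> 0) by (intros E; apply (f_equal Re) in E; cbn in E; lra).
  replace (f (RtoC (d / 2))) with (zero : V) in H
    by exact (pseries_unique c _ _ _ (Hz _ Hd2) (Hf (RtoC (d / 2)))).
  replace (c 0%nat) with (opp (minus zero (c 0%nat))) by module_ring V.
  rewrite (norm_opp (V := V)); apply Rlt_le, H.
  replace (RtoC (d / 2) - 0)%C with (RtoC (d / 2)) by ring.
  rewrite Cmod_R, Rabs_pos_eq; lra. }
induction k as [|k IH]; [exact H0|]; intros c Hc Hz.
apply (IH (PS_decr_1 c) (abs_summable_decr c Hc)); intros z Hz0.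
pose proof (is_pseries_decr_1 (K := C_AbsRing) (V := V) c z (/ z)%C zero (Cinv_l z Hz0) (Hz z Hz0)) as H.
apply (eq_ind _ (is_pseries (K := C_AbsRing) (V := V) (PS_decr_1 c) z) H).
rewrite (H0 c Hc Hz); module_ring V.
Qed.

Lemma pseries_coef_unique (c d : nat -> V) (f : C -> V) : abs_summable c -> abs_summable d ->
  (forall z, is_pseries (K := C_AbsRing) c z (f z)) ->
  (forall z, is_pseries (K := C_AbsRing) d z (f z)) -> forall k, c k = d k.
Proof.
intros Hc Hd Hcf Hdf k.
assert (H : minus (c k) (d k) = zero).
{ apply (pseries_zero_coef k (fun k => minus (c k) (d k)));
    [apply abs_summable_minus; assumption|]; intros z _.
  apply (eq_ind _ (is_pseries (K := C_AbsRing) (V := V) (fun k => minus (c k) (d k)) z)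
    (is_pseries_minus (K := C_AbsRing) (V := V) c d z _ _ (Hcf z) (Hdf z))).
  module_ring V. }
transitivity (plus (minus (c k) (d k)) (d k)); [module_ring V|].
rewrite H; module_ring V.
Qed.

Lemma ex_series_geometric q M : 0 <= q < 1 ->
  ex_series (V := R_NormedModule) (fun k => M * q ^ k).
Proof.
intros Hq; eexists.
apply (is_series_scal (V := R_NormedModule) M), is_series_geom; rewrite Rabs_pos_eq; lra.
Qed.

Lemma taylor_coef_abs_summable (f : C -> V) :
  (forall z, ex_derive (K := C_AbsRing) f z) -> abs_summable (taylor_coef V f).
Proof.
intros Hf r Hr.
(* The estimate on the circle of radius [r + 1] gives ratio [r / (r + 1) < 1]. *)
destruct (taylor_coef_bound V f Hf (ln (r + 1))) as [M [HM0 HM]].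
assert (Hs : exp (- ln (r + 1)) = / (r + 1)) by (rewrite exp_Ropp, exp_ln; lra).
rewrite Hs in HM.
apply ex_series_R_le with (y := fun k => M * (r / (r + 1)) ^ k).
- intros k; assert (0 <= r ^ k) by (apply pow_le, Hr).
  split; [apply Rmult_le_pos; [apply norm_ge_0|assumption]|].
  replace (M * (r / (r + 1)) ^ k) with (M * (/ (r + 1)) ^ k * r ^ k)
    by (unfold Rdiv; rewrite Rpow_mult_distr; ring).
  apply Rmult_le_compat_r; [assumption|apply HM].
- apply ex_series_geometric; split.
  + apply Rmult_le_pos; [exact Hr|apply Rlt_le, Rinv_0_lt_compat; lra].
  + apply Rmult_lt_reg_r with (r + 1); [lra|].
    unfold Rdiv; rewrite Rmult_assoc, Rinv_l by lra; lra.
Qed.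

End EntirePowerSeries.

(** * Conjugation symmetry *)

Lemma cplx_conj_scal (B : ModuleSpace R_Ring) (z : C) (u : cplx B) :
  cplx_conj (scal z u) = scal (Cconj z) (cplx_conj u).
Proof.
destruct z as [x y], u as [v w].
change (cplx_conj (cplx_scal B (x, y) (Cplx v w))
  = cplx_scal B (x, - y) (cplx_conj (Cplx v w))).
unfold cplx_conj, cplx_scal; cbn.
rewrite !scal_Ropp, !scal_opp_r, (opp_plus (G := B)), !(opp_opp (G := B)); reflexivity.
Qed.

Section Complexified.

Variables (B : CompleteNormedModule R_AbsRing) (N : complexification_norm B).

(** The radii [exp n] are cofinal: [r <= n <= exp n] for large [n]. *)
Lemma exp_decreasing_iff (a : nat -> B) :
  exp_decreasing a <-> abs_summable (complexification N) (coeffs N a).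
Proof.
assert (Hnorm : forall k, norm (coeffs N a k) = norm (a k))
  by (intros k; exact (cplx_norm_of_real B N (a k))).
assert (Hexp : forall k n, exp (INR k * INR n) = exp (INR n) ^ k).
{ intros k n; induction k as [|k IH]; [cbn; rewrite Rmult_0_l; apply exp_0|].
  rewrite S_INR, Rmult_plus_distr_r, exp_plus, IH, Rmult_1_l; cbn; ring. }
split; intros H.
- intros r Hr; destruct (INR_unbounded r) as [n Hn].
  apply ex_series_R_le with (2 := H n); intros k; rewrite Hnorm, Hexp.
  split; [apply Rmult_le_pos; [apply norm_ge_0|apply pow_le, Hr]|].
  apply Rmult_le_compat_l; [apply norm_ge_0|]; apply pow_incr.
  pose proof (exp_ineq1_le (INR n)); lra.
- intros n; apply (ex_series_ext (V := R_NormedModule)) with (2 := H (exp (INR n)) (Rlt_le _ _ (exp_pos _))).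
  intros k; cbn beta; rewrite Hnorm, Hexp; reflexivity.
Qed.

Lemma cplx_conj_plus (u v : complexification N) :
  cplx_conj (plus u v) = plus (cplx_conj u : complexification N) (cplx_conj v).
Proof.
change (Cplx (plus (cplx_re u) (cplx_re v)) (opp (plus (cplx_im u) (cplx_im v)))
  = Cplx (plus (cplx_re u) (cplx_re v)) (plus (opp (cplx_im u)) (opp (cplx_im v)))).
f_equal; exact (opp_plus (G := B) _ _).
Qed.

Lemma pow_n_conj (z : C) k :
  pow_n (K := C_Ring) (Cconj z) k = Cconj (pow_n (K := C_Ring) z k).
Proof.
induction k as [|k IH].
- apply injective_projections; cbn; ring.
- cbn [pow_n]; rewrite IH; symmetry; apply Cmult_conj.
Qed.

(** Conjugation is additive, semilinear and isometric, so it carries partial sums to partial sums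
    and keeps their distance to the limit. *)
Lemma pseries_conj (c : nat -> complexification N) z v :
  is_pseries (K := C_AbsRing) c z v ->
  is_pseries (K := C_AbsRing) (fun k => cplx_conj (c k) : complexification N) (Cconj z)
    (cplx_conj v : complexification N).
Proof.
intros H; apply filterlim_locally; intros eps.
apply filter_imp with (2 := proj1 (filterlim_locally _ _) H eps); intros n Hn.
set (S := sum_n (fun k => scal (pow_n (K := C_Ring) z k) (c k)) n : complexification N) in *.
assert (E : sum_n (fun k => scal (pow_n (K := C_Ring) (Cconj z) k)
    (cplx_conj (c k) : complexification N)) n = cplx_conj S).
{ unfold S; clear; induction n as [|n IH].
  - rewrite !sum_O, pow_n_conj; symmetry; exact (cplx_conj_scal B _ _).
  - rewrite !sum_Sn, IH, pow_n_conj.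
    refine (eq_trans _ (eq_sym (cplx_conj_plus _ _))); f_equal.
    symmetry; exact (cplx_conj_scal B _ _). }
change (N (minus S v) < eps) in Hn.
change (N (minus (sum_n (fun k => scal (pow_n (K := C_Ring) (Cconj z) k)
    (cplx_conj (c k) : complexification N)) n) (cplx_conj v)) < eps).
rewrite E.
apply Rle_lt_trans with (2 := Hn), Req_le.
refine (eq_trans _ (cplx_norm_conj B N (minus S v))); apply f_equal.
symmetry; exact (cplx_conj_plus S (opp v)).
Qed.

Lemma coeffs_conj (a : nat -> B) k : cplx_conj (coeffs N a k) = coeffs N a k.
Proof.
unfold cplx_conj, coeffs, of_real; cbn; f_equal; exact (opp_zero (G := B)).
Qed.

(** The imaginary part satisfies [y = - y], so [2 y = 0], and [norm_scal_2_ge] forces its norm to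
    vanish. *)
Lemma real_of_conj_fixed (u : complexification N) : cplx_conj u = u -> u = of_real (cplx_re u).
Proof.
destruct u as [x y]; unfold cplx_conj, of_real; cbn; intros H; injection H; intros Hy.
f_equal; apply (norm_eq_zero (V := B)), Rle_antisym; [|apply norm_ge_0].
pose proof (norm_scal_2_ge B y) as H2.
assert (E : plus y y = zero) by (rewrite <- Hy at 1; exact (plus_opp_l (G := B) y)).
rewrite scal_2 in H2.
pose proof (Rle_trans _ _ _ H2
  (Req_le _ _ (eq_trans (f_equal (fun v : B => norm v) E) (norm_zero (V := B))))); lra.
Qed.

Lemma exp_decreasing_represents (a : nat -> B) :
  exp_decreasing a -> exists f : C -> complexification N, represents N a f.
Proof.
intros Ha; apply exp_decreasing_iff in Ha.
exists (fun z => proj1_sig (constructive_indefinite_description _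
  (abs_summable_pseries (complexification N) (coeffs N a) z Ha))).
intros z; exact (proj2_sig (constructive_indefinite_description _
  (abs_summable_pseries (complexification N) (coeffs N a) z Ha))).
Qed.

Lemma represents_conj_symmetric (a : nat -> B) (f : C -> complexification N) :
  represents N a f -> conj_symmetric N f.
Proof.
intros Hf z; apply (pseries_unique (complexification N) (coeffs N a) (Cconj z)); [|apply Hf].
apply (is_pseries_ext (K := C_AbsRing) (V := complexification N)) with (2 := pseries_conj _ _ _ (Hf z)).
intros k; apply coeffs_conj.
Qed.

Lemma entire_symmetric_represented (f : C -> complexification N) :
  entire N f -> conj_symmetric N f ->
  exists a : nat -> B, exp_decreasing a /\ represents N a f.
Proof.
intros Hf Hsym; set (c := taylor_coef (complexification N) f).
pose proof (entire_taylor (complexification N) f Hf) as Hc; fold c in Hc.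
pose proof (taylor_coef_abs_summable (complexification N) f Hf) as Hs; fold c in Hs.
assert (Hconj : forall k, cplx_conj (c k) = c k).
{ apply (pseries_coef_unique (complexification N) (fun k => cplx_conj (c k)) c f); auto.
  - intros r Hr; apply (ex_series_ext (V := R_NormedModule)) with (2 := Hs r Hr).
    intros k; f_equal; symmetry; exact (cplx_norm_conj B N (c k)).
  (* The conjugated series at [z] sums to the conjugate of [f (Cconj z)], which is [f z] by
     symmetry. *)
  - intros z; pose proof (pseries_conj c _ _ (Hc (Cconj z))) as H.
    rewrite Hsym, Cconj_conj in H; exact H. }
assert (Hre : forall k, coeffs N (fun k => cplx_re (c k)) k = c k)
  by (intros k; symmetry; apply real_of_conj_fixed, Hconj).
exists (fun k => cplx_re (c k)); split.
- apply exp_decreasing_iff; intros r Hr.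
  apply (ex_series_ext (V := R_NormedModule)) with (2 := Hs r Hr); intros k.
  rewrite Hre; reflexivity.
- intros z; apply (is_pseries_ext (K := C_AbsRing) (V := complexification N)) with (2 := Hc z).
  intros k; symmetry; apply Hre.
Qed.

End Complexified.

(* The first two clauses say that sending a sequence to the sum of its power
   series is well defined and injective on the space of exponentially
   decreasing sequences; the third identifies its image. *)
Theorem corollary2p13 (B : CompleteNormedModule R_AbsRing)
    (N : complexification_norm B) :
  (forall a : nat -> B, exp_decreasing a ->
     exists f : C -> complexification N, represents N a f) /\
  (forall (a b : nat -> B) (f : C -> complexification N),
     exp_decreasing a -> exp_decreasing b ->
     represents N a f -> represents N b f -> forall k : nat, a k = b k) /\
  (forall f : C -> complexification N,
     (exists a : nat -> B, exp_decreasing a /\ represents N a f) <->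
     (entire N f /\ conj_symmetric N f)).
Proof.
split; [exact (exp_decreasing_represents B N)|split].
- intros a b f Ha Hb Hfa Hfb k.
  apply (exp_decreasing_iff B N) in Ha; apply (exp_decreasing_iff B N) in Hb.
  exact (f_equal cplx_re (pseries_coef_unique _ _ _ f Ha Hb Hfa Hfb k)).
- intros f; split.
  + intros [a [Ha Hf]]; split; [|exact (represents_conj_symmetric B N a f Hf)].
    intros z; apply (pseries_holomorphic _ (coeffs N a) f z); [|exact Hf].
    apply exp_decreasing_iff, Ha.
  + intros [Hf Hsym]; exact (entire_symmetric_represented B N f Hf Hsym).
Qed.
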